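(* Assume: (A1) $\sup_{i,j}\|X_{ij}\|=O(\sqrt{p_n})$; (A2) the unknown parameter $\beta_n$ belongs to a compact subset $\mathcal{B}\subseteq\mathbb{R}^{p_n}$, the true value $\beta_{n0}$ lies in the interior of $\mathcal{B}$, and there are constants $b_1,b_2$ (not depending on $n$) with $0<b_1\le\pi_{ij}(\beta_{n0})\le b_2<1$ for all $i,j$; (A3) there are positive constants $b_3,b_4$ with $b_3\le\lambda_{\min}\big(n^{-1}\sum_{i=1}^nX_i^TX_i\big)\le\lambda_{\max}\big(n^{-1}\sum_{i=1}^nX_i^TX_i\big)\le b_4$; (A4) the common true correlation matrix $R_0$ has eigenvalues bounded away from $0$ and $+\infty$, and the estimated working correlation matrix $\widehat R$ satisfies $\|\widehat R^{-1}-\overline R^{-1}\|=O_p(\sqrt{p_n/n})$, where $\overline R$ is a constant positive definite matrix with eigenvalues bounded away from $0$ and $+\infty$ ($\overline R$ is not required to equal $R_0$). Let $\widehat\beta_n$ be the GEE estimator, i.e. a root of $S_n(\beta_n)=0$ with $\|\widehat\beta_n-\beta_{n0}\|=O_p(\sqrt{p_n/n})$. If $n^{-1}p_n^3=o(1)$, then for all $\alpha_n\in\mathbb{R}^{p_n}$ with $\|\alpha_n\|=1$, $$\alpha_n^T\,\overline M_n^{-1/2}(\beta_{n0})\,\overline H_n(\beta_{n0})\,(\widehat\beta_n-\beta_{n0})\to N(0,1)\quad\text{in distribution.}$$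
   Context: Setting: the number of clusters $n\to\infty$, the cluster size $m<\infty$ is a fixed integer, and the number of covariates $p_n\to\infty$ as $n\to\infty$. For each $n$, each cluster $i=1,\dots,n$ and each $j=1,\dots,m$, one observes a binary response $Y_{ij}\in\{0,1\}$ and a covariate vector $X_{ij}\in\mathbb{R}^{p_n}$ (covariates are treated as fixed: all moments and probabilities are conditional on them; dependence on $n$ is suppressed). $Y_i=(Y_{i1},\dots,Y_{im})^T$, and $X_i=(X_{i1},\dots,X_{im})^T$ is the $m\times p_n$ matrix with rows $X_{ij}^T$. $Y_1,\dots,Y_n$ are independent; components of one $Y_i$ may be dependent. For $\beta\in\mathbb{R}^{p_n}$ let $\pi_{ij}(\beta)=\exp(X_{ij}^T\beta)/[1+\exp(X_{ij}^T\beta)]$ and $\pi_i(\beta)=(\pi_{i1}(\beta),\dots,\pi_{im}(\beta))^T$. The true parameter $\beta_{n0}$ satisfies $E(Y_{ij})=\pi_{ij}(\beta_{n0})$, hence $\mathrm{Var}(Y_{ij})=\pi_{ij}(\beta_{n0})(1-\pi_{ij}(\beta_{n0}))$. All $Y_i$ have the same $m\times m$ true correlation matrix $R_0$. $A_i(\beta)$ is the $m\times m$ diagonal matrix with $j$th diagonal entry $A_{ij}(\beta)=\pi_{ij}(\beta)(1-\pi_{ij}(\beta))$. $\widehat R$ is an estimated $m\times m$ working correlation matrix (random, and not depending on the argument $\beta_n$ of the estimating function). Define $$S_n(\beta_n)=\sum_{i=1}^nX_i^TA_i^{1/2}(\beta_n)\widehat R^{-1}A_i^{-1/2}(\beta_n)\big(Y_i-\pi_i(\beta_n)\big),$$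 $$\overline M_n(\beta_n)=\sum_{i=1}^nX_i^TA_i^{1/2}(\beta_n)\overline R^{-1}R_0\overline R^{-1}A_i^{1/2}(\beta_n)X_i,\qquad \overline H_n(\beta_n)=\sum_{i=1}^nX_i^TA_i^{1/2}(\beta_n)\overline R^{-1}A_i^{1/2}(\beta_n)X_i.$$ $\overline M_n^{-1/2}$ is the inverse of the symmetric positive definite square root. $\|\cdot\|$ is the Euclidean norm for vectors and the Frobenius norm for matrices; $\lambda_{\min},\lambda_{\max}$ denote smallest and largest eigenvalues. *)

(* Defs.v *)
From HB Require Import structures.
From mathcomp Require Import all_boot all_order all_algebra.
From mathcomp Require Import all_classical all_reals all_analysis.

Set Implicit Arguments.
Unset Strict Implicit.
Unset Printing Implicit Defensive.

Import Order.TTheory GRing.Theory Num.Theory.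
Import numFieldNormedType.Exports.

Local Open Scope classical_set_scope.
Local Open Scope ring_scope.

Section matrices.
Context {R : realType}.

(* Frobenius norm, hence the Euclidean norm of row and column vectors; the
   library norm `|A| on matrices is the maximum norm. *)
Definition fnorm (a b : nat) (A : 'M[R]_(a, b)) : R :=
  Num.sqrt (\sum_(i < a) \sum_(j < b) A i j ^+ 2).

(* Only meant for symmetric matrices of positive size, whose set of real
   eigenvalues is finite and nonempty. *)
Definition lambda_min (a : nat) (A : 'M[R]_a) : R := inf [set x | eigenvalue A x].
Definition lambda_max (a : nat) (A : 'M[R]_a) : R := sup [set x | eigenvalue A x].

Definition eigenvalues_bounded_away (a : nat) (A : nat -> 'M[R]_a) : Prop :=
  exists c C : R, 0 < c /\
    forall n (x : R), eigenvalue (A n) x -> c <= x <= C.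

Definition sym_posdef (a : nat) (A : 'M[R]_a) : Prop :=
  A^T = A /\ forall v : 'cV[R]_a, v != 0 -> 0 < (v^T *m A *m v) 0 0.

Definition mxsqrt (a : nat) (A : 'M[R]_a) : 'M[R]_a :=
  xget 0 [set Q | sym_posdef Q /\ Q *m Q = A].

End matrices.

Section probability.
Context {R : realType}.

Definition measurable_mx d (T : measurableType d) (a b : nat)
    (M : T -> 'M[R]_(a, b)) : Prop :=
  forall i j, measurable_fun setT (fun w => M w i j).

(* Since setT belongs to every sigma-algebra, the product rule over the whole
   family contains the product rule over each of its subfamilies. *)
Definition independent_vectors d (T : measurableType d) (P : probability T R)
    (n m : nat) (Y : 'I_n -> 'I_m -> T -> R) : Prop :=
  forall A : 'I_n -> set T,
    (forall i, g_sigma_preimage (Y i) (A i)) ->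
    P (\bigcap_(i in [set: 'I_n]) A i) = (\prod_(i < n) P (A i))%E.

Definition correlation d (T : measurableType d) (P : probability T R)
    (U V : T -> R) : R :=
  fine (covariance P U V) /
    (Num.sqrt (fine 'V_P[U]) * Num.sqrt (fine 'V_P[V])).

(* The n-th variable lives on its own probability space. *)
Definition bigO_prob (d : nat -> measure_display)
    (T : forall n, measurableType (d n)) (P : forall n, probability (T n) R)
    (Z : forall n, T n -> R) (r : nat -> R) : Prop :=
  forall e : R, 0 < e -> exists2 M : R, 0 < M &
    \forall n \near \oo, (P n [set w | (M * r n < `|Z n w|)%R] <= e%:E)%E.

Definition cvg_in_distribution (d : nat -> measure_display)
    (T : forall n, measurableType (d n)) (P : forall n, probability (T n) R)
    (Z : forall n, T n -> R) (mu : probability (measurableTypeR R) R) : Prop :=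
  forall x : R, {for x, continuous (fun y : R => mu `]-oo, y]%classic)} ->
    P n [set w | (Z n w <= x)%R] @[n --> \oo] --> mu `]-oo, x]%classic.

End probability.

(* Throughout, X i is the m x p matrix whose rows are the covariate vectors of
   cluster i. *)
Section gee.
Context {R : realType}.

Definition logistic (x : R) : R := expR x / (1 + expR x).

Section cluster.
Variables (m p : nat) (X : 'M[R]_(m, p)) (beta : 'cV[R]_p).

Definition prob_vec : 'cV[R]_m := \col_j logistic ((X *m beta) j 0).

Definition binvar (j : 'I_m) : R := prob_vec j 0 * (1 - prob_vec j 0).

Definition A_half : 'M[R]_m := diag_mx (\row_j Num.sqrt (binvar j)).

Definition A_mhalf : 'M[R]_m := diag_mx (\row_j (Num.sqrt (binvar j))^-1).

End cluster.

Section sample.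
Variables (n m p : nat) (X : 'I_n -> 'M[R]_(m, p)).

(* invmx fixes singular matrices, so this is the estimating function only when
   Rhat is invertible; the rate assumed of invmx Rhat around the inverse of a
   well-conditioned matrix makes Rhat invertible with probability tending
   to 1. *)
Definition score (Y : 'I_n -> 'cV[R]_m) (Rhat : 'M[R]_m) (beta : 'cV[R]_p) :
    'cV[R]_p :=
  \sum_(i < n) (X i)^T *m A_half (X i) beta *m invmx Rhat
                 *m A_mhalf (X i) beta *m (Y i - prob_vec (X i) beta).

Definition M_bar (Rbar R0 : 'M[R]_m) (beta : 'cV[R]_p) : 'M[R]_p :=
  \sum_(i < n) (X i)^T *m A_half (X i) beta *m invmx Rbar *m R0
                 *m invmx Rbar *m A_half (X i) beta *m X i.

Definition H_bar (Rbar : 'M[R]_m) (beta : 'cV[R]_p) : 'M[R]_p :=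
  \sum_(i < n) (X i)^T *m A_half (X i) beta *m invmx Rbar
                 *m A_half (X i) beta *m X i.

(* n^-1 sum_i X_i^T X_i *)
Definition gram : 'M[R]_p := n%:R^-1 *: \sum_(i < n) (X i)^T *m X i.

(* sup_(i, j) ||X_ij|| *)
Definition max_covariate_norm : R :=
  \big[Num.max/0]_(i < n) \big[Num.max/0]_(j < m) fnorm (row j (X i)).

End sample.
End gee.

(* Main.v *)
Require Import Defs.
From HB Require Import structures.
From mathcomp Require Import all_boot all_order all_algebra.
From mathcomp Require Import all_classical all_reals all_analysis.
From mathcomp Require Import measurable_realfun.
From mathcomp Require Import ring lra.
From mathcomp Require complex.

Set Implicit Arguments.
Unset Strict Implicit.
Unset Printing Implicit Defensive.

Import Order.TTheory GRing.Theory Num.Theory.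
Import numFieldNormedType.Exports.

Local Open Scope classical_set_scope.
Local Open Scope ring_scope.

(** Put [delta = betahat - beta0] and [a = M^(-1/2) alpha], where [M] and [H]
    are the matrices M_bar and H_bar at [beta0]; then [a^T M a = 1] and the
    statistic is [a^T H delta].  Let [W] be [a^T] times the estimating function
    at [beta0] in which the estimated inverse correlation matrix is replaced by
    its limit.  Two things are true: [a^T H delta - W] tends to 0 in
    probability, and [W] is asymptotically standard normal.

    The first is a Taylor expansion of the equation [a^T S(betahat) = 0], and
    all of it takes place in the scalars [x_ij = (X_i a)_j] and
    [h_ij = (X_i delta)_j].  The eigenvalue conditions give
    [sum x_ij^2 = O(1)] (covariate_along_M_bar) and [sum h_ij^2 = O_P(p)]
    (covariate_along_bounds), and the bound on the covariates gives
    [max |h_ij| = O_P(p / sqrt n)].  Errors quadratic in [h], or linear in [h]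
    times the error of the working correlation, are bounded path by path
    through [sum |x_ij| h_ij^2 <= max |h| sum |x_ij| |h_ij|]
    (score_linearization, cross_sum_bound).  The errors that are linear in the
    residuals are too large for that.  In those, the random factors [delta]
    and the working correlation are pulled out of the sum over clusters; what
    is left is a sum of independent centred variables with deterministic
    weights, which is controlled in mean square (slope_term_bound,
    level_term_bound, noise_mean).  Every error is a constant times
    [p sqrt (p / n) = sqrt (p^3 / n)] (one_sample_remainder), which is where
    the growth condition enters.

    The second is a central limit theorem for a sum of independent centred
    terms, one for each cluster, whose variances add up to [a^T M a = 1]
    (cluster_score_variance) and whose size is uniformly
    [O(sqrt (p / n))] (cluster_score_bound).  Because the responses are binary,
    their joint law is a finite product (responses_law), and the theorem is a
    statement on finite sums (clt_bounded).  Its proof replaces the summands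
    one at a time along the function [Phi ((b - x) / sqrt r)], which solves the
    heat equation in [r] and [x]: replacing a centred summand of variance
    [sigma^2] by an increase of [r] by [sigma^2] costs only
    [O(max |xi| sigma^2)] (heat_step).  In this form no normal variable and no
    convolution is needed.

    The bound on the remainder holds outside an event of small probability;
    one_sample_law turns this into a two-sided bound of the distribution
    function of the statistic by that of [W], and the continuity of [Phi]
    finishes the proof. *)

(** * The standard normal distribution function *)

Section normal_cdf.
Variable R : realType.
Implicit Types (x z t h : R).

Definition std_pdf : R -> R := normal_pdf 0 1.
Definition std_cdf x : R := fine (normal_prob (0:R) 1 `]-oo, x]%classic).

Lemma std_pdfE x : std_pdf x = (Num.sqrt (pi *+ 2))^-1 * expR (- (x ^+ 2 / 2)).
Proof.
rewrite /std_pdf normal_pdfE ?oner_eq0 // /normal_peak /normal_fun.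
by rewrite expr1n mul1r subr0 mulNr.
Qed.

(** The fundamental theorem of calculus on a half-line, the density being
    continuous and integrable. *)
Lemma std_cdf_derive x : is_derive x 1 std_cdf (std_pdf x).
Proof.
have intf : lebesgue_measure.-integrable [set` Interval -oo%O (BRight (x + 1))]
    (EFin \o std_pdf).
  by apply: (integrableS _ _ (subsetT _)) => //; exact: integrable_normal_pdf.
have -> : std_cdf = fun y =>
    (\int[lebesgue_measure]_(t in [set` Interval -oo%O (BRight y)]) std_pdf t)%R by [].
have [] := @continuous_FTC1 R std_pdf -oo%O x (x + 1) _ intf.
- by rewrite ltrDl.
- by rewrite ltNyr.
- by apply: continuous_normal_pdf; rewrite oner_eq0.
move=> dF FE; apply: DeriveDef; first exact: dF.
by rewrite -derive1E.
Qed.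

(** A Taylor bound is obtained by applying this lemma once for each order: the
    bound for the derivative, of order [k], gives the bound of order [k + 1]
    for the function. The factorials are given up for a single constant. *)
Lemma mean_value_bound (f f' : R -> R) (C : R) k x :
  (forall y, is_derive y (1:R) f (f' y)) ->
  (forall y, `|y| <= `|x| -> `|f' y| <= C * `|y| ^+ k) -> 0 <= C ->
  `|f x - f 0| <= C * `|x| ^+ k.+1.
Proof.
move=> df bd C0.
have cf a b : {within `[a, b], continuous f}.
  apply: continuous_subspaceT => y.
  by apply/differentiable_continuous/derivable1_diffP; case: (df y).
have [x0|x0] := leP 0 x.
  have [c + ->] := MVT_segment x0 (fun y _ => df y) (cf 0 x).
  rewrite in_itv /= => /andP[c0 cx]; rewrite subr0 normrM exprSr mulrA.
  have ccx : `|c| <= `|x| by rewrite !ger0_norm.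
  rewrite ler_wpM2r // (le_trans (bd c ccx)) // ler_wpM2l // lerXn2r ?nnegrE //.
have [c + E] := MVT_segment (ltW x0) (fun y _ => df y) (cf x 0).
rewrite in_itv /= => /andP[c0 cx].
rewrite distrC E sub0r normrM normrN exprSr mulrA.
have ccx : `|c| <= `|x| by rewrite !ler0_norm ?lerN2 // ltW.
by rewrite ler_wpM2r // (le_trans (bd c ccx)) // ler_wpM2l // lerXn2r ?nnegrE.
Qed.

Lemma std_pdf_ge0 z : 0 <= std_pdf z.
Proof. exact: normal_pdf_ge0. Qed.

(** From [1 + y <= exp y] at [y = z^2 / 4], squared. All the derivatives met
    below are a polynomial of degree at most 3 times the density, so that this
    one estimate bounds them. *)
Lemma std_pdf_decay z : (1 + z ^+ 2) ^+ 2 * std_pdf z <= 16.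
Proof.
rewrite std_pdfE.
have pi1 : 1 <= (pi *+ 2 : R).
  by rewrite mulr2n; have := pi_ge2 R; lra.
have s1 : (Num.sqrt (pi *+ 2 : R))^-1 <= 1.
  by rewrite invf_le1 ?sqrtr_gt0 ?(lt_le_trans _ pi1) // -sqrtr1 ler_wsqrtr.
have e1 : (1 + z ^+ 2 / 4) ^+ 2 <= expR (z ^+ 2 / 2).
  have -> : z ^+ 2 / 2 = 2%:R * (z ^+ 2 / 4) by field.
  rewrite expRM_natl lerXn2r ?nnegrE ?expR_ge0 ?expR_ge1Dx //.
  by rewrite addr_ge0 // mulr_ge0 // sqr_ge0.
have e2 : (1 + z ^+ 2) ^+ 2 <= 16 * expR (z ^+ 2 / 2).
  apply: le_trans (ler_wpM2l _ e1) => //.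
  have := sqr_ge0 z; nra.
have e3 : expR (z ^+ 2 / 2) * expR (- (z ^+ 2 / 2)) = 1 by rewrite expRxMexpNx_1.
have p0 := expR_ge0 (- (z ^+ 2 / 2)).
apply: (@le_trans _ _ ((1 + z ^+ 2) ^+ 2 * expR (- (z ^+ 2 / 2)))).
  rewrite ler_wpM2l ?sqr_ge0 // ler_piMl //.
apply: le_trans (ler_wpM2r p0 e2) _.
by rewrite -mulrA e3 mulr1.
Qed.

Lemma std_pdf_derive z : is_derive z 1 std_pdf (- (z * std_pdf z)).
Proof.
have pdfE x : std_pdf x = (Num.sqrt (pi *+ 2))^-1 * expR (- 2^-1 * (x * x)).
  by rewrite std_pdfE expr2 mulNr [2^-1 * _]mulrC.
rewrite pdfE; have -> : std_pdf = (Num.sqrt (pi *+ 2))^-1 \*: (expR \o (fun x : R => - 2^-1 * (x * x))).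
  exact/funext.
have d1 : is_derive z (1:R) (fun x : R => - 2^-1 * (x * x)) (- z).
  by apply: is_derive_eq; rewrite /GRing.scale /=; field.
have d2 := @is_derive1_comp R expR _ z _ _ (is_derive_expR _) d1.
have d3 := @is_deriveZ R R R _ (Num.sqrt (pi *+ 2))^-1 z 1 _ d2.
by apply: (is_derive_eq d3); rewrite /GRing.scale /=; ring.
Qed.

Lemma is_derive_translate (f : R -> R) (df z h : R) :
  is_derive (z + h) 1 f df -> is_derive h 1 (fun y => f (z + y)) df.
Proof.
move=> dfz; have dg : is_derive h (1:R) (fun y : R => z + y) 1.
  by apply: is_derive_eq; rewrite add0r mulr1.
have := @is_derive1_comp R f (fun y => z + y) h df 1 dfz dg.
by rewrite mulr1.
Qed.

(** The derivatives of [Phi] are [phi], [- z phi] and [(z^2 - 1) phi]. *)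
Lemma std_cdf_taylor3 z h :
  `|std_cdf (z + h) - std_cdf z - std_pdf z * h + z * std_pdf z * (h ^+ 2 / 2)|
    <= 16 * `|h| ^+ 3.
Proof.
pose g2 y := (z + y) * std_pdf (z + y).
pose G2 y := z * std_pdf z - g2 y.
pose G1 y := std_pdf (z + y) - std_pdf z + z * std_pdf z * y.
pose G0 y := std_cdf (z + y) - std_cdf z - std_pdf z * y + z * std_pdf z * (y ^+ 2 / 2).
have dG2 y : is_derive y (1:R) G2 (((z + y) ^+ 2 - 1) * std_pdf (z + y)).
  have dp := is_derive_translate (std_pdf_derive (z + y)).
  apply: is_derive_eq; rewrite /GRing.scale /=; ring.
have dG1 y : is_derive y (1:R) G1 (G2 y).
  have dp := is_derive_translate (std_pdf_derive (z + y)).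
  apply: is_derive_eq; rewrite /G2 /g2 /GRing.scale /=; ring.
have dG0 y : is_derive y (1:R) G0 (G1 y).
  have dp := is_derive_translate (std_cdf_derive (z + y)).
  by apply: is_derive_eq; rewrite /G1 /GRing.scale /=; field.
have b2 y : `|G2 y| <= 16 * `|y| ^+ 1.
  have -> : G2 y = G2 y - G2 0 by rewrite [G2 0]/G2 /g2 addr0 subrr subr0.
  apply: (mean_value_bound dG2) => // x _; rewrite expr0 mulr1.
  apply: le_trans (std_pdf_decay (z + x)).
  rewrite normrM (ger0_norm (std_pdf_ge0 _)) ler_wpM2r ?std_pdf_ge0 //.
  rewrite ler_norml; have := sqr_ge0 (z + x); nra.
have b1 y : `|G1 y| <= 16 * `|y| ^+ 2.
  have -> : G1 y = G1 y - G1 0 by rewrite [G1 0]/G1 addr0 subrr mulr0 addr0 subr0.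
  by apply: (mean_value_bound dG1) => // x _.
have -> : std_cdf (z + h) - std_cdf z - std_pdf z * h + z * std_pdf z * (h ^+ 2 / 2)
   = G0 h - G0 0.
  by rewrite /G0 addr0; field.
by apply: (mean_value_bound dG0) => // x _.
Qed.

(** With the scale written as [exp (- t)], each derivative in [t] of a function
    of [w = z exp (- t)] is again a function of [w] alone, [w] times the
    derivative up to sign; hence the bound is uniform in [z], although the
    displacement [w - z] is not. *)
Lemma std_cdf_dilation z t :
  `|std_cdf (z * expR (- t)) - std_cdf z + t * (z * std_pdf z)| <= 16 * t ^+ 2.
Proof.
pose w y := z * expR (- y).
pose g y := y * std_pdf y.
pose K1 y := g z - g (w y).
pose K0 y := std_cdf (w y) - std_cdf z + y * g z.
have dw y : is_derive y (1:R) w (- w y).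
  have de := @is_derive1_comp R expR -%R y (expR (- y)) (-1) (is_derive_expR _) (is_deriveNid _ _).
  apply: is_derive_eq; rewrite /GRing.scale /w /=; ring.
have dg y : is_derive y (1:R) g ((1 - y ^+ 2) * std_pdf y).
  have dp := std_pdf_derive y.
  apply: is_derive_eq; rewrite /GRing.scale /=; ring.
have dK1 y : is_derive y (1:R) K1 (w y * ((1 - w y ^+ 2) * std_pdf (w y))).
  have dgw := is_derive1_comp (dg (w y)) (dw y).
  apply: is_derive_eq; ring.
have dK0 y : is_derive y (1:R) K0 (K1 y).
  have dgw := is_derive1_comp (std_cdf_derive (w y)) (dw y).
  apply: is_derive_eq; rewrite /GRing.scale /K1 /g /=; ring.
have b1 y : `|K1 y| <= 16 * `|y| ^+ 1.
  have -> : K1 y = K1 y - K1 0.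
    by rewrite [K1 0]/K1 /w oppr0 expR0 mulr1 subrr subr0.
  apply: (mean_value_bound dK1) => // x _; rewrite expr0 mulr1.
  move: (w x) => u; apply: le_trans (std_pdf_decay u).
  rewrite mulrA normrM (ger0_norm (std_pdf_ge0 _)) ler_wpM2r ?std_pdf_ge0 //.
  by rewrite ler_norml; apply/andP; split; nra.
have -> : std_cdf (z * expR (- t)) - std_cdf z + t * (z * std_pdf z) = K0 t - K0 0.
  by rewrite /K0 /w /g oppr0 expR0 mulr1; ring.
have -> : t ^+ 2 = `|t| ^+ 2 by rewrite real_normK ?num_real.
by apply: (mean_value_bound dK0) => // x _.
Qed.

End normal_cdf.

(** * One step of the Lindeberg replacement *)

Section heat_step.
Variable R : realType.
Implicit Types (x z t h : R).

(** As a function of [r] and [x] this solves the heat equation [d/dr = 1/2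
    d^2/dx^2]; as [r] tends to 0 it becomes the indicator of [x < a], except at
    [x = a]. *)
Definition heat (a r x : R) : R := std_cdf ((a - x) / Num.sqrt r).

Lemma std_pdf_le z : std_pdf z <= 16.
Proof.
apply: le_trans (std_pdf_decay z).
rewrite ler_peMl ?std_pdf_ge0 // expr_ge1 // ?addr_ge0 ?sqr_ge0 //.
by rewrite lerDl sqr_ge0.
Qed.

Lemma std_pdf_mul_le z : `|z * std_pdf z| <= 16.
Proof.
apply: le_trans (std_pdf_decay z).
rewrite normrM (ger0_norm (std_pdf_ge0 _)) ler_wpM2r ?std_pdf_ge0 //.
by rewrite ler_norml; apply/andP; split; nra.
Qed.

Lemma ln1D_bounds (v : R) : 0 <= v -> v - v ^+ 2 <= ln (1 + v) <= v.
Proof.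
move=> v0; have v1 : 0 < 1 + v by rewrite ltr_wpDr.
apply/andP; split.
  have h : 1 + - ln (1 + v) <= (1 + v)^-1.
    by rewrite -[X in _ <= X]lnK ?posrE ?invr_gt0 // lnV ?posrE // expR_ge1Dx.
  have e : (1 + v)^-1 <= 1 - v + v ^+ 2.
    by rewrite -[X in X <= _]div1r ler_pdivrMr //; nra.
  by lra.
by rewrite -[leRHS]expRK ler_ln ?posrE ?expR_gt0 // expR_ge1Dx.
Qed.

(** The increment in [r] is a dilation by [(1 + v)^(-1/2) = exp (- ln (1 + v) /
    2)] of the argument of [Phi]. *)
Lemma heat_time_step (a x r v z : R) :
  0 < r -> 0 <= v -> z = (a - x) / Num.sqrt r ->
  `|heat a (r * (1 + v)) x - std_cdf z + v / 2 * (z * std_pdf z)| <= 16 * v ^+ 2.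
Proof.
move=> r0 v0 zE; have v1 : 0 < 1 + v by rewrite ltr_wpDr.
pose t := ln (1 + v) / 2.
have zt : (a - x) / Num.sqrt (r * (1 + v)) = z * expR (- t).
  rewrite zE sqrtrM ?ltW // invfM mulrA; congr (_ * _).
  rewrite expRN; congr (_^-1); apply/eqP.
  rewrite -(@eqrXn2 _ 2) ?sqrtr_ge0 ?expR_ge0 // sqr_sqrtr ?ltW // -expRM_natl.
  by rewrite /t mulrC divfK ?lnK.
have := std_cdf_dilation z t; rewrite -zt -/(heat _ _ _).
have /andP[l1 l2] := ln1D_bounds v0.
have zp := std_pdf_mul_le z.
move: (z * std_pdf z) zp => g; rewrite ler_norml => /andP[g1 g2].
have t1 : 0 <= v / 2 - t by rewrite /t; lra.
have t2 : v / 2 - t <= v ^+ 2 / 2 by rewrite /t; lra.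
have t0 : 0 <= t by rewrite /t divr_ge0 // ln_ge0 // lerDl.
have tt : t ^+ 2 <= v ^+ 2 / 4 by nra.
rewrite !ler_norml => /andP[h1 h2].
have e1 : (v / 2 - t) * g <= v ^+ 2 / 2 * 16 by nra.
have e2 : - (v ^+ 2 / 2 * 16) <= (v / 2 - t) * g by nra.
apply/andP; split; lra.
Qed.

(** A centred variable of variance [sig] and an increase of [r] by [sig] have
    the same effect up to the third order: both change the value by [sig / 2]
    times the second derivative in [x]. The increase of [r] leaves an error
    [sig^2 <= eps * sig], no larger than the bound [eps * sig] of the third
    absolute moment. *)
Lemma heat_step (F : finType) (mu xi : F -> R) (a x r s eps sig : R) :
  0 < s -> s ^+ 2 <= r -> 0 <= eps <= 1 ->
  (forall y, 0 <= mu y) -> \sum_y mu y = 1 -> \sum_y mu y * xi y = 0 ->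
  \sum_y mu y * xi y ^+ 2 = sig -> (forall y, `|xi y| <= eps) ->
  `|\sum_y mu y * heat a r (x + xi y) - heat a (r + sig) x|
    <= 16 * (s ^- 3 + s ^- 4) * eps * sig.
Proof.
move=> s0 sr /andP[eps0 eps1] mu0 mu1 mean0 var bd.
have r0 : 0 < r by rewrite (lt_le_trans _ sr) // exprn_gt0.
set rho := Num.sqrt r; have rho0 : 0 < rho by rewrite sqrtr_gt0.
have rho2 : rho ^+ 2 = r by rewrite sqr_sqrtr // ltW.
have srho : s <= rho by rewrite -ler_sqr ?nnegrE ?(ltW s0) ?(ltW rho0) // rho2.
pose z := (a - x) / rho.
have sig0 : 0 <= sig by rewrite -var sumr_ge0 // => y _; rewrite mulr_ge0 ?sqr_ge0.
have sigeps : sig <= eps.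
  rewrite -var; apply: (@le_trans _ _ (\sum_y mu y * eps)).
    apply: ler_sum => y _; rewrite ler_wpM2l //.
    rewrite -real_normK ?num_real //; have := bd y; have := normr_ge0 (xi y); nra.
  by rewrite -mulr_suml mu1 mul1r.
have := @heat_time_step a x r (sig / r) z r0 (divr_ge0 sig0 (ltW r0)) erefl.
have -> : r * (1 + sig / r) = r + sig by rewrite mulrDr mulr1 mulrC divfK ?gt_eqF.
move=> time.
pose T y := std_cdf (z + - xi y / rho) - std_cdf z - std_pdf z * (- xi y / rho)
  + z * std_pdf z * ((- xi y / rho) ^+ 2 / 2).
have ET : \sum_y mu y * T y = \sum_y mu y * heat a r (x + xi y) - std_cdf z
    + (sig / r) / 2 * (z * std_pdf z).
  transitivity (\sum_y (mu y * heat a r (x + xi y) - mu y * std_cdf z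
     + (mu y * xi y) * (std_pdf z / rho)
     + (mu y * xi y ^+ 2) * (z * std_pdf z / (r * 2)))).
    apply: eq_bigr => y _; rewrite /T /heat -/rho.
    have -> : (a - (x + xi y)) / rho = z + - xi y / rho by rewrite /z; ring.
    by rewrite -rho2; field; rewrite gt_eqF.
  rewrite !big_split /= sumrN -!mulr_suml mu1 mean0 var mul0r mul1r addr0.
  by congr (_ + _); field; rewrite gt_eqF.
have BT : `|\sum_y mu y * T y| <= 16 * s ^- 3 * eps * sig.
  apply: (le_trans (ler_norm_sum _ _ _)).
  rewrite -var mulr_sumr; apply: ler_sum => y _.
  rewrite normrM (ger0_norm (mu0 y)) mulrCA ler_wpM2l //.
  apply: le_trans (std_cdf_taylor3 _ _) _.
  have -> : `|- xi y / rho| ^+ 3 = rho ^- 3 * (`|xi y| * xi y ^+ 2).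
    rewrite normrM normrN exprMn mulrC (@ger0_norm _ rho^-1) ?invr_ge0 ?(ltW rho0) //.
    by rewrite exprVn [`|xi y| ^+ 3]exprS real_normK ?num_real.
  have -> : 16 * s ^- 3 * eps * xi y ^+ 2 = 16 * (s ^- 3 * (eps * xi y ^+ 2)).
    by rewrite !mulrA.
  rewrite ler_wpM2l // ler_pM ?invr_ge0 ?exprn_ge0 ?(ltW rho0) //.
  - by rewrite mulr_ge0 ?sqr_ge0.
  - by rewrite lef_pV2 ?posrE ?exprn_gt0 // lerXn2r ?nnegrE // ltW.
  - by rewrite ler_wpM2r ?sqr_ge0.
have BV : 16 * (sig / r) ^+ 2 <= 16 * s ^- 4 * eps * sig.
  have -> : (sig / r) ^+ 2 = rho ^- 4 * (sig * sig).
    by rewrite -rho2 exprMn mulrC exprVn -exprM expr2.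
  have -> : 16 * s ^- 4 * eps * sig = 16 * (s ^- 4 * (eps * sig)).
    by rewrite !mulrA.
  rewrite ler_wpM2l // ler_pM ?invr_ge0 ?exprn_ge0 ?(ltW rho0) //.
  - by rewrite mulr_ge0.
  - by rewrite lef_pV2 ?posrE ?exprn_gt0 // lerXn2r ?nnegrE // ltW.
  - by rewrite ler_wpM2r.
have -> : \sum_y mu y * heat a r (x + xi y) - heat a (r + sig) x
  = \sum_y mu y * T y - (heat a (r + sig) x - std_cdf z + sig / r / 2 * (z * std_pdf z)).
  by rewrite ET; ring.
apply: le_trans (ler_normB _ _) _.
have -> : 16 * (s ^- 3 + s ^- 4) * eps * sig
  = 16 * s ^- 3 * eps * sig + 16 * s ^- 4 * eps * sig by ring.
by rewrite lerD // (le_trans time).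
Qed.

End heat_step.

(** * Finite product laws and sums of small independent terms *)

Section product_law.
Variables (R : realType) (n : nat) (F : finType) (mu : 'I_n -> F -> R).
Hypothesis mu_ge0 : forall i y, 0 <= mu i y.
Hypothesis mu_sum1 : forall i, \sum_y mu i y = 1.
Implicit Types (G : {ffun 'I_n -> F} -> R) (w : {ffun 'I_n -> F}).

Definition prod_pmf w : R := \prod_i mu i (w i).
Definition prod_mean G : R := \sum_w prod_pmf w * G w.
Definition set_coordinate w (k : 'I_n) (y : F) : {ffun 'I_n -> F} :=
  [ffun i => if i == k then y else w i].

Lemma prod_pmf_ge0 w : 0 <= prod_pmf w.
Proof. by apply: prodr_ge0. Qed.

Lemma prod_pmf_sum1 : \sum_w prod_pmf w = 1.
Proof. by rewrite /prod_pmf -bigA_distr_bigA big1. Qed.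

Lemma prod_mean_cst c : prod_mean (fun=> c) = c.
Proof. by rewrite /prod_mean -mulr_suml prod_pmf_sum1 mul1r. Qed.

Lemma prod_mean_le G H : (forall w, G w <= H w) -> prod_mean G <= prod_mean H.
Proof. by move=> GH; apply: ler_sum => w _; rewrite ler_wpM2l ?prod_pmf_ge0. Qed.

Lemma prod_meanD G H : prod_mean (fun w => G w + H w) = prod_mean G + prod_mean H.
Proof. by rewrite -big_split; apply: eq_bigr => w _; rewrite mulrDr. Qed.

Lemma prod_meanZ c G : prod_mean (fun w => c * G w) = c * prod_mean G.
Proof. by rewrite mulr_sumr; apply: eq_bigr => w _; rewrite mulrCA. Qed.

Lemma prod_mean_sum (I : finType) (G : I -> {ffun 'I_n -> F} -> R) :
  prod_mean (fun w => \sum_i G i w) = \sum_i prod_mean (G i).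
Proof.
by rewrite exchange_big; apply: eq_bigr => w _; rewrite mulr_sumr.
Qed.

Lemma prod_mean_norm_le G c :
  (forall w, `|G w| <= c) -> `|prod_mean G| <= c.
Proof.
move=> bd; rewrite -[leRHS]prod_mean_cst.
apply: (le_trans (ler_norm_sum _ _ _)); apply: ler_sum => w _.
by rewrite normrM (ger0_norm (prod_pmf_ge0 w)) ler_wpM2l ?prod_pmf_ge0.
Qed.

Lemma prod_pmf_set_coordinate w k y :
  prod_pmf (set_coordinate w k y) * mu k (w k) = prod_pmf w * mu k y.
Proof.
rewrite /prod_pmf (bigD1 k) //= [in RHS](bigD1 k) //= ffunE eqxx.
rewrite (eq_bigr (fun i => mu i (w i))); first by ring.
by move=> i /negbTE ik; rewrite ffunE ik.
Qed.

(** Independence of coordinate [k] of the others, in the form in which it is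
    used below: drawing that coordinate again does not change the mean. The map
    that exchanges the old and the new value of the coordinate is an involution
    that preserves the weights. *)
Lemma prod_mean_resample k G :
  prod_mean G = prod_mean (fun w => \sum_y mu k y * G (set_coordinate w k y)).
Proof.
(* Exchanges the value of coordinate k with the spare value. *)
pose sw (u : {ffun 'I_n -> F} * F) := (set_coordinate u.1 k u.2, u.1 k).
have swK : involutive sw.
  move=> [w y]; rewrite /sw /= ffunE eqxx; congr pair; apply/ffunP => i.
  by rewrite !ffunE; case: eqP => // ->.
transitivity (\sum_u prod_pmf u.1 * mu k u.2 * G (set_coordinate u.1 k u.2)); last first.
  rewrite [RHS](eq_bigr (fun w => \sum_y prod_pmf w * mu k y * G (set_coordinate w k y))).
    by rewrite pair_bigA.
  by move=> w _; rewrite mulr_sumr; apply: eq_bigr => y _; rewrite mulrA.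
transitivity (\sum_u prod_pmf u.1 * mu k u.2 * G u.1).
  rewrite -(pair_bigA _ (fun w y => prod_pmf w * mu k y * G w)) /=.
  by apply: eq_bigr => w _; rewrite -!mulr_suml -mulr_sumr mu_sum1 mulr1.
rewrite (reindex_inj (inv_inj swK)) /=.
by apply: eq_bigr => -[w y] _ /=; rewrite prod_pmf_set_coordinate.
Qed.

(** Lindeberg's telescoping. The function [f k] is applied to the partial sum
    of the first [k] terms, and each step is compared conditionally on the
    other coordinates. *)
Lemma prod_mean_telescope (f : nat -> R -> R) (xi : 'I_n -> F -> R) (err : 'I_n -> R) :
  (forall k x, `|\sum_y mu k y * f k.+1 (x + xi k y) - f k x| <= err k) ->
  `|prod_mean (fun w => f n (\sum_i xi i (w i))) - f 0%N 0| <= \sum_k err k.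
Proof.
move=> step.
pose D j := prod_mean (fun w => f j (\sum_(i < n | (i < j)%N) xi i (w i))).
have DS (k : 'I_n) : `|D k.+1 - D k| <= err k.
  rewrite {1}/D (prod_mean_resample k) -[- D k]mulN1r -prod_meanZ -prod_meanD.
  apply: prod_mean_norm_le => w; rewrite mulN1r.
  rewrite (eq_bigr (fun y => mu k y *
      f k.+1 (\sum_(i < n | (i < k)%N) xi i (w i) + xi k y))) //.
  move=> y _; congr (_ * f _ _); rewrite (bigD1 k) //= ffunE eqxx addrC.
  congr (_ + _); apply: eq_big => i.
    by rewrite ltnS andbC ltn_neqAle.
  by rewrite ltnS => /andP[_ /negbTE ik]; rewrite ffunE ik.
have key j : (j <= n)%N -> `|D j - f 0%N 0| <= \sum_(i < n | (i < j)%N) err i.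
  elim: j => [_|j IH jn].
    have -> : D 0%N = f 0%N 0.
      rewrite -[RHS]prod_mean_cst; congr prod_mean; apply/funext => w.
      by rewrite big_pred0.
    by rewrite big_pred0 // subrr normr0.
  rewrite -(subrKA (D j)) (le_trans (ler_normD _ _)) //.
  rewrite (bigD1 (Ordinal jn)) //= lerD ?(DS (Ordinal jn)) //.
  rewrite (eq_bigl (fun i : 'I_n => (i < j)%N)) ?IH 1?ltnW // => i.
  by rewrite ltnS andbC ltn_neqAle.
have := key n (leqnn _).
have all_lt (i : 'I_n) : (i < n)%N = true by rewrite ltn_ord.
rewrite (eq_bigl xpredT) //; have -> // : D n = prod_mean (fun w => f n (\sum_i xi i (w i))).
by congr prod_mean; apply/funext => w; rewrite (eq_bigl xpredT).
Qed.

Section linear_statistic.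
Variables (xi : 'I_n -> F -> R) (sig : 'I_n -> R).
Hypothesis mean0 : forall i, \sum_y mu i y * xi i y = 0.
Hypothesis var_xi : forall i, \sum_y mu i y * xi i y ^+ 2 = sig i.

Lemma cluster_variance_ge0 i : 0 <= sig i.
Proof. by rewrite -var_xi sumr_ge0 // => y _; rewrite mulr_ge0 ?sqr_ge0. Qed.

Let tail k : R := \sum_(i < n | (k <= i)%N) sig i.

Let tailS (k : 'I_n) : tail k = tail k.+1 + sig k.
Proof.
rewrite /tail (bigD1 k) //= addrC; congr (_ + _); apply: eq_bigl => i.
by rewrite [in RHS]ltn_neqAle andbC eq_sym.
Qed.

Let tailn : tail n = 0.
Proof. by rewrite /tail big_pred0 // => i; rewrite leqNgt ltn_ord. Qed.

Let tail0 : tail 0%N = \sum_i sig i.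
Proof. by []. Qed.

(** Telescoping with [f k x = x^2 + (variance of the terms from k on)], for
    which every step is exact. *)
Lemma prod_mean_variance :
  prod_mean (fun w => (\sum_i xi i (w i)) ^+ 2) = \sum_i sig i.
Proof.
have := @prod_mean_telescope (fun k x => x ^+ 2 + tail k) xi (fun=> 0).
rewrite expr0n add0r tail0 tailn sumr_const mul0rn => /(_ _).
have -> : (fun w : {ffun 'I_n -> F} => (\sum_i xi i (w i)) ^+ 2 + 0) =
  fun w => (\sum_i xi i (w i)) ^+ 2 by apply/funext => w; rewrite addr0.
rewrite normr_le0 subr_eq0 => h; apply/eqP; apply: h.
move=> k x; rewrite normr_le0 subr_eq0; apply/eqP.
transitivity (\sum_y (mu k y * (x ^+ 2 + tail k.+1) + (mu k y * xi k y) * (2 * x)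
   + mu k y * xi k y ^+ 2)).
  by apply: eq_bigr => y _; ring.
rewrite !big_split /= -!mulr_suml mu_sum1 mean0 var_xi tailS; ring.
Qed.

(** Telescoping with the heat function whose [r] is [s^2] plus the variance of
    the terms that are still to come. *)
Lemma lindeberg_heat (a s eps : R) : 0 < s -> 0 <= eps <= 1 ->
  (forall i y, `|xi i y| <= eps) ->
  `|prod_mean (fun w => heat a (s ^+ 2) (\sum_i xi i (w i)))
     - heat a (s ^+ 2 + \sum_i sig i) 0|
   <= 16 * (s ^- 3 + s ^- 4) * eps * \sum_i sig i.
Proof.
move=> s0 e01 bd.
have := @prod_mean_telescope (fun k x => heat a (s ^+ 2 + tail k) x) xi
  (fun k => 16 * (s ^- 3 + s ^- 4) * eps * sig k).
rewrite -mulr_sumr tailn tail0 addr0; apply => k x.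
rewrite [tail k]tailS addrA; apply: heat_step => //.
by rewrite lerDl sumr_ge0 // => i _; apply: cluster_variance_ge0.
Qed.

End linear_statistic.
End product_law.

Section clt.
Variable R : realType.
Implicit Types (x z t h : R).

Lemma std_cdf_itv x : 0 <= std_cdf x <= 1.
Proof.
rewrite /std_cdf fine_ge0 //= -lee_fin fineK ?fin_num_measure //.
exact: probability_le1.
Qed.

Lemma std_cdf_nondecreasing x z : x <= z -> std_cdf x <= std_cdf z.
Proof.
move=> xz; rewrite /std_cdf fine_le ?fin_num_measure //.
by rewrite le_measure ?inE //; apply: subset_itvl; rewrite bnd_simp.
Qed.

(** The constant is the bound on the density from std_pdf_decay. *)
Lemma std_cdf_lipschitz x z : `|std_cdf x - std_cdf z| <= 16 * `|x - z|.
Proof.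
have d y : is_derive y (1:R) (fun y => std_cdf (z + y)) (std_pdf (z + y)).
  exact/is_derive_translate/std_cdf_derive.
have := @mean_value_bound _ _ _ 16 0 (x - z) d.
rewrite addr0 [z + _]addrC subrK expr1; apply => // y _.
by rewrite expr0 mulr1 ger0_norm ?std_pdf_ge0 // std_pdf_le.
Qed.

Let idTR : measurableTypeR R -> R := idfun.

#[local] HB.instance Definition _ :=
  @isMeasurableFun.Build _ _ _ _ idTR (@measurable_id _ _ setT).

Lemma std_cdf_tails (e : R) : 0 < e ->
  exists2 L, 1 <= L & 1 - e <= std_cdf L /\ std_cdf (- L) <= e.
Proof.
move=> e0.
pose N : probability (measurableTypeR R) R := normal_prob (0:R) 1.
have cy : (fine \o cdf (idTR : {RV N >-> R})) x @[x --> +oo] --> (1:R).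
  by apply: fine_cvg; exact: cvg_cdfy1.
have cNy : (fine \o cdf (idTR : {RV N >-> R})) x @[x --> -oo] --> (0:R).
  by apply: fine_cvg; exact: cvg_cdfNy0.
have [L1 l1] : exists L1, forall x, L1 < x -> 1 - e <= std_cdf x.
  have /cvgrPdist_le/(_ _ e0) [L1 [_ h]] := cy; exists L1 => x /h /=.
  by rewrite ler_norml => /andP[_]; rewrite -/(std_cdf x); lra.
have [L2 l2] : exists L2, forall x, x < L2 -> std_cdf x <= e.
  have /cvgrPdist_le/(_ _ e0) [L2 [_ h]] := cNy; exists L2 => x /h /=.
  by rewrite ler_norml => /andP[]; rewrite -/(std_cdf x); lra.
exists (1 + `|L1| + `|L2|); first by rewrite -addrA lerDl addr_ge0.
split.
  by apply: l1; have := ler_norm L1; have := normr_ge0 L2; lra.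
by apply: l2; have := ler_norm (- L2); rewrite normrN; have := normr_ge0 L1; lra.
Qed.

(** The heat function at [r = s^2] is a smoothed indicator of a half-line: it
    is close to the indicator of [x <= a] from above when centred at [a + del]
    and from below when centred at [a - del], provided that [del / s] is large.
    The quantifiers make [eps] depend on the point and the precision only,
    which is the uniformity needed for a triangular array. *)
Lemma clt_bounded (a e : R) : 0 < e ->
  exists2 eps, 0 < eps &
    forall (n : nat) (F : finType) (mu xi : 'I_n -> F -> R),
    (forall i y, 0 <= mu i y) -> (forall i, \sum_y mu i y = 1) ->
    (forall i, \sum_y mu i y * xi i y = 0) ->
    \sum_i \sum_y mu i y * xi i y ^+ 2 = 1 ->
    (forall i y, `|xi i y| <= eps) ->
    std_cdf a - e <= prod_mean mu (fun w => (\sum_i xi i (w i) <= a)%R%:R)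
      <= std_cdf a + e.
Proof.
move=> e0; have e4 : 0 < e / 4 by rewrite divr_gt0.
have [L L1 [tail1 tail0]] := std_cdf_tails e4.
have aa0 : 0 < 64 * (`|a| + 2) by rewrite mulr_gt0 // ltr_wpDl.
pose del := Num.min 1 (e / (64 * (`|a| + 2))).
have del0 : 0 < del by rewrite lt_min ltr01 divr_gt0.
have del1 : del <= 1 by rewrite ge_min lexx.
have dele : del * (64 * (`|a| + 2)) <= e.
  by rewrite -ler_pdivlMr // ge_min lexx orbT.
have L0 : 0 < L by rewrite (lt_le_trans _ L1).
(* The smoothing scale: at distance del from its centre the smoothed indicator
   is within e / 4 of 0 or 1. *)
pose s := del / L; have s0 : 0 < s by rewrite divr_gt0.
have sdel : s <= del by rewrite ler_pdivrMr // ler_peMr // ltW.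
have ss : s ^+ 2 <= del by nra.
pose K := 16 * (s ^- 3 + s ^- 4).
have K0 : 0 < K by rewrite mulr_gt0 // addr_gt0 // invr_gt0 exprn_gt0.
exists (Num.min 1 (e / (4 * K))); first by rewrite lt_min ltr01 divr_gt0 // mulr_gt0.
move=> n F mu xi mu0 mu1 mean0 var1 bd.
have e01 : 0 <= Num.min 1 (e / (4 * K)) <= 1.
  apply/andP; split; last by rewrite ge_min lexx.
  rewrite le_min ler01 divr_ge0 ?(ltW e0) // mulr_ge0 ?(ltW K0) //.
have Ke : K * Num.min 1 (e / (4 * K)) <= e / 4.
  have -> : e / 4 = K * (e / (4 * K)).
    by move: K0; clearbody K => K0; field; rewrite gt_eqF.
  by rewrite ler_wpM2l ?ge_min ?lexx ?orbT // ltW.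
have lind b := @lindeberg_heat R n F mu mu0 mu1 xi _ mean0 (fun=> erefl) b s _ s0 e01 bd.
rewrite var1 in lind.
(* The value at the far end of the telescoping is Phi (b / sqrt (s^2 + 1)), where
   both b - a and s^2 are at most del. *)
have heat_end b : `|b - a| <= del -> `|heat b (s ^+ 2 + 1) 0 - std_cdf a| <= e / 4.
  move=> ba; rewrite /heat subr0; apply: le_trans (std_cdf_lipschitz _ _) _.
  set r := Num.sqrt _.
  have r2 : r ^+ 2 = s ^+ 2 + 1 by rewrite sqr_sqrtr // addr_ge0 // sqr_ge0.
  have r0 : 0 <= r by rewrite sqrtr_ge0.
  have r1 : 1 <= r by nra.
  have q1 : r^-1 <= 1 by rewrite invf_le1 // (lt_le_trans _ r1).
  have q2 : 1 - del <= r^-1.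
    by rewrite -[leRHS]div1r ler_pdivlMr ?(lt_le_trans _ r1) //; nra.
  have -> : b / r - a = (b - a) * r^-1 - a * (1 - r^-1) by ring.
  have h1 : `|(b - a) * r^-1| <= del.
    by rewrite normrM -[leRHS]mulr1 ler_pM // ger0_norm // invr_ge0.
  have h2 : `|a * (1 - r^-1)| <= `|a| * del.
    by rewrite normrM ler_wpM2l // ger0_norm; lra.
  apply: (@le_trans _ _ (16 * (del + `|a| * del))).
    by rewrite ler_wpM2l // (le_trans (ler_normB _ _)) // lerD.
  have := normr_ge0 a; nra.
have heat01 b S : 0 <= heat b (s ^+ 2) S <= 1 by apply: std_cdf_itv.
have sqs : Num.sqrt (s ^+ 2) = s by rewrite sqrtr_sqr ger0_norm // ltW.
have up S : (S <= a)%R%:R <= heat (a + del) (s ^+ 2) S + e / 4.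
  have [Sa|Sa] := leP S a; last first.
    by have /andP[h _] := heat01 (a + del) S; rewrite addr_ge0 // ltW.
  rewrite -lerBlDr (le_trans tail1) // /heat sqs; apply: std_cdf_nondecreasing.
  have -> : L = del / s by rewrite /s; field; rewrite !gt_eqF.
  by rewrite ler_pM2r ?invr_gt0 //; lra.
have dn S : heat (a - del) (s ^+ 2) S - e / 4 <= (S <= a)%R%:R.
  have [Sa|Sa] := leP S a.
    by have /andP[_ h] := heat01 (a - del) S; rewrite lerBlDr (le_trans h) // lerDl ltW.
  rewrite lerBlDr add0r (le_trans _ tail0) // /heat sqs; apply: std_cdf_nondecreasing.
  have -> : - L = - del / s by rewrite /s; field; rewrite !gt_eqF.
  by rewrite ler_pM2r ?invr_gt0 //; lra.
have := heat_end (a + del); have := heat_end (a - del).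
have -> : a - del - a = - del by ring.
have -> : a + del - a = del by ring.
rewrite normrN (ger0_norm (ltW del0)) => /(_ (lexx _)) he1 /(_ (lexx _)) he2.
have := lind (a + del); have := lind (a - del); rewrite -/K mulr1 => li1 li2.
have m1 : prod_mean mu (fun w => (\sum_i xi i (w i) <= a)%R%:R) <=
    prod_mean mu (fun w => heat (a + del) (s ^+ 2) (\sum_i xi i (w i))) + e / 4.
  by rewrite -[X in _ + X](prod_mean_cst mu1) -prod_meanD; apply: prod_mean_le.
have m2 : prod_mean mu (fun w => heat (a - del) (s ^+ 2) (\sum_i xi i (w i))) - e / 4
    <= prod_mean mu (fun w => (\sum_i xi i (w i) <= a)%R%:R).
  rewrite lerBlDr -[X in _ <= _ + X](prod_mean_cst mu1) -prod_meanD.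
  by apply: prod_mean_le => // w; rewrite -lerBlDr; apply: dn.
move: he1 he2 li1 li2; rewrite !ler_norml.
move=> /andP[? ?] /andP[? ?] /andP[? ?] /andP[? ?].
by apply/andP; split; lra.
Qed.

End clt.

(** * Real symmetric matrices *)

Section spectral_decomposition.
Import complex.

(** Spectral theorem for a real symmetric matrix, deduced from the one for
    Hermitian matrices. The orthonormal eigenbasis that this gives is complex,
    so the conclusion keeps only what is real: the eigenvalues [d], and for
    each vector the squared moduli [w] of its coordinates. Evaluating arbitrary
    polynomials in the matrix makes this enough for Rayleigh quotients, norms
    and square roots. *)
Lemma symmetric_spectral_of_closure (R : rcfType) (C : numClosedFieldType)
    (f : {rmorphism R -> C}) (n : nat) (A : 'M[R]_n.+1) :
  (forall x, (0 <= f x) = (0 <= x)) ->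
  (forall z : C, z \is Num.real -> exists x, f x = z) ->
  A^T = A ->
  exists d : 'I_n.+1 -> R,
    [/\ forall i, eigenvalue A (d i),
        forall q : {poly R}, (forall i, q.[d i] = 0) -> horner_mx A q = 0
      & forall v : 'cV[R]_n.+1, exists w : 'I_n.+1 -> R,
          [/\ forall i, 0 <= w i,
              \sum_i w i = \sum_i v i 0 ^+ 2
            & forall q : {poly R},
                (v^T *m horner_mx A q *m v) 0 0 = \sum_i q.[d i] * w i]].
Proof.
move=> f0 freal symA.
have fI : injective f := fmorph_inj f.
have realfx x : f x \is Num.real.
  by rewrite realE f0 -oppr_ge0 -rmorphN f0 oppr_ge0 le_total.
pose AC := map_mx f A.
have hermAC : AC \is hermsymmx.
  apply: realsym_hermsym.
    apply/is_hermitianmxP; rewrite expr0 scale1r.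
    by apply/matrixP => i j; rewrite !mxE -[in LHS]symA mxE.
  by apply/mxOverP => i j; rewrite mxE.
have realD := hermitian_spectral_diag_real hermAC.
have /orthomx_spectralP ACE := hermitian_normalmx hermAC.
have Pun := spectral_unitarymx AC.
have Pu := spectral_unit AC.
move: (spectralmx AC) (spectral_diag AC) ACE realD Pun Pu => P D ACE realD Pun Pu.
have [d fd] : exists d, forall i, f (d i) = D 0 i.
  by apply: (@fin_all_exists _ _ (fun i x => f x = D 0 i)) => i; apply: freal; apply: (mxOverP realD).
have qA (q : {poly R}) : map_mx f (horner_mx A q) =
    invmx P *m diag_mx (\row_i f q.[d i]) *m P.
  rewrite map_horner_mx -/AC ACE.
  rewrite (horner_mx_uconjC (map_poly f q) (diag_mx D) Pu) horner_mx_diag.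
  congr (_ *m diag_mx _ *m _); apply/rowP => i.
  by rewrite mxE [RHS]mxE -fd horner_map.
exists d; split.
- move=> i; rewrite -(eigenvalue_map f) -/AC.
  apply/eigenvalueP; exists (row i P).
    have /(congr1 (row i)) : P *m AC = diag_mx D *m P.
      by rewrite ACE !mulmxA mulmxV // mul1mx.
    rewrite row_mul => ->.
    by apply/rowP => k; rewrite mul_diag_mx !mxE fd.
  apply/eqP => r0.
  move: Pu; rewrite -row_free_unit => /row_freeP [B /(congr1 (row i))].
  rewrite row_mul r0 mul0mx => /rowP /(_ i); rewrite !mxE eqxx => /esym/eqP.
  by rewrite oner_eq0.
- move=> q q0; apply/eqP; rewrite -(map_mx_eq0 f) qA.
  have -> : \row_i f q.[d i] = 0 by apply/rowP => i; rewrite !mxE q0 rmorph0.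
  have -> : diag_mx 0 = 0 :> 'M[C]_n.+1.
    by apply/matrixP => i j; rewrite !mxE mul0rn.
  by rewrite mulmx0 mul0mx eqxx.
move=> v; pose u := P *m map_mx f v.
have [w fw] : exists w, forall i, f (w i) = (u i 0)^* * u i 0.
  apply: (@fin_all_exists _ _ (fun i x => f x = (u i 0)^* * u i 0)) => i.
  by apply: freal; rewrite mulrC ger0_real // mul_conjC_ge0.
have quad q : f ((v^T *m horner_mx A q *m v) 0 0) = f (\sum_i q.[d i] * w i).
  transitivity ((map_mx f (v^T *m horner_mx A q *m v)) 0 0); first by rewrite [RHS]mxE.
  rewrite !map_mxM qA invmx_unitary // -(map_trmx f).
  have vr : map_mx Num.conj (map_mx f v)^T = (map_mx f v)^T.
    by apply: realmxC; apply/mxOverP => i j; rewrite mxE [X in X \is _]mxE.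
  have -> : (map_mx f v)^T *m (map_mx Num.conj P^T *m diag_mx (\row_i f q.[d i]) *m P)
      *m map_mx f v = map_mx Num.conj u^T *m diag_mx (\row_i f q.[d i]) *m u.
    by rewrite /u trmx_mul map_mxM vr !mulmxA.
  rewrite mxE rmorph_sum; apply: eq_bigr => i _.
  rewrite mul_mx_diag rmorphM fw; clearbody u.
  have -> : (\matrix_(k, j) ((map_mx Num.conj u^T) k j * (\row_i0 f q.[d i0]) 0 j)) 0 i
     = (u i 0)^* * f q.[d i] by rewrite !mxE.
  by rewrite mulrCA mulrA.
exists w; split.
- by move=> i; rewrite -f0 fw mulrC mul_conjC_ge0.
- have := fI _ _ (quad 1).
  rewrite rmorph1 mulmx1 mxE => E; apply/esym.
  transitivity (\sum_j v^T 0 j * v j 0).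
    by apply: eq_bigr => i _; rewrite mxE expr2.
  by rewrite E; apply: eq_bigr => i _; rewrite hornerC mul1r.
- by move=> q; apply: fI.
Qed.

Lemma symmetric_spectral (R : rcfType) (n : nat) (A : 'M[R]_n.+1) :
  A^T = A ->
  exists d : 'I_n.+1 -> R,
    [/\ forall i, eigenvalue A (d i),
        forall q : {poly R}, (forall i, q.[d i] = 0) -> horner_mx A q = 0
      & forall v : 'cV[R]_n.+1, exists w : 'I_n.+1 -> R,
          [/\ forall i, 0 <= w i,
              \sum_i w i = \sum_i v i 0 ^+ 2
            & forall q : {poly R},
                (v^T *m horner_mx A q *m v) 0 0 = \sum_i q.[d i] * w i]].
Proof.
apply: (@symmetric_spectral_of_closure _ _ (real_complex R)).
  exact: ler0c.
by move=> [x y]; rewrite complex_real /= => /eqP ->; exists x.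
Qed.

End spectral_decomposition.

Section quadratic_forms.
Variable R : realType.

Definition sqnorm (n : nat) (v : 'cV[R]_n) : R := \sum_i v i 0 ^+ 2.

Lemma sqnorm_ge0 n (v : 'cV[R]_n) : 0 <= sqnorm v.
Proof. by apply: sumr_ge0 => i _; rewrite sqr_ge0. Qed.

Lemma sqnormE n (v : 'cV[R]_n) : sqnorm v = (v^T *m v) 0 0.
Proof. by rewrite mxE; apply: eq_bigr => i _; rewrite mxE expr2. Qed.

Lemma fnorm_sqr n (v : 'cV[R]_n) : fnorm v ^+ 2 = sqnorm v.
Proof.
have E : \sum_(i < n) \sum_(j < 1) v i j ^+ 2 = sqnorm v.
  by apply: eq_bigr => i _; rewrite big_ord1.
by rewrite /fnorm E sqr_sqrtr // sqnorm_ge0.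
Qed.

Lemma sqnorm_gt0 n (v : 'cV[R]_n) : v != 0 -> 0 < sqnorm v.
Proof.
move=> v0; rewrite lt_def sqnorm_ge0 andbT; apply: contra_neq v0 => s0.
apply/colP => i; rewrite mxE; apply/eqP; rewrite -sqrf_eq0.
by move/psumr_eq0P: s0 => -> // j _; rewrite sqr_ge0.
Qed.

(** The quadratic form is the sum of the [d i * w i], with nonnegative weights
    of total [sqnorm v]. *)
Lemma symmetric_spectrum_bounds n (A : 'M[R]_n) c C (v : 'cV[R]_n) :
  A^T = A -> (forall x, eigenvalue A x -> c <= x <= C) ->
  c * sqnorm v <= (v^T *m A *m v) 0 0 <= C * sqnorm v.
Proof.
case: n A v => [|n] A v symA bd.
  by rewrite /sqnorm mxE !big_ord0 !mulr0 lexx.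
have [d [eigd _ /(_ v) [w [w0 sw /(_ 'X)]]]] := symmetric_spectral symA.
rewrite horner_mx_X => ->; have -> : sqnorm v = \sum_i w i by rewrite sw.
rewrite !mulr_sumr.
by apply/andP; split; apply: ler_sum => i _; rewrite hornerX ler_wpM2r //;
  have /andP[] := bd _ (eigd i).
Qed.

(** The same argument for the polynomial [X^2], as [sqnorm (A v) = v^T A^2 v].
    *)
Lemma symmetric_spectrum_norm_bounds n (A : 'M[R]_n) c C (v : 'cV[R]_n) :
  A^T = A -> 0 < c -> (forall x, eigenvalue A x -> c <= x <= C) ->
  c ^+ 2 * sqnorm v <= sqnorm (A *m v) <= C ^+ 2 * sqnorm v.
Proof.
case: n A v => [|n] A v symA c0 bd.
  by rewrite /sqnorm !big_ord0 !mulr0 lexx.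
have [d [eigd _ /(_ v) [w [w0 sw /(_ ('X^2))]]]] := symmetric_spectral symA.
have -> : horner_mx A 'X^2 = A *m A by rewrite rmorphXn /= horner_mx_X expr2.
have -> : v^T *m (A *m A) *m v = (A *m v)^T *m (A *m v).
  by rewrite trmx_mul symA !mulmxA.
rewrite -sqnormE => ->; have -> : sqnorm v = \sum_i w i by rewrite sw.
rewrite !mulr_sumr.
apply/andP; split; apply: ler_sum => i _; rewrite hornerXn ler_wpM2r //;
  have /andP[cd dC] := bd _ (eigd i).
  by rewrite ler_sqr ?nnegrE ?(le_trans (ltW c0)) // ltW.
have d0 := lt_le_trans c0 cd.
by rewrite ler_sqr ?nnegrE ?(le_trans (ltW d0)) // ltW.
Qed.

(** The infimum and the supremum are meaningful only because the spectrum is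
    bounded. *)
Lemma symmetric_eigenvalue_lambda n (A : 'M[R]_n) x :
  A^T = A -> eigenvalue A x -> lambda_min A <= x <= lambda_max A.
Proof.
case: n A => [|n] A symA eigx.
  by have /eigenvalueP[v _ /eqP[]] := eigx; apply/rowP; case.
have [d [eigd _ spec]] := symmetric_spectral symA.
(* A bound on the whole spectrum, by the Rayleigh quotient of an eigenvector. *)
pose K := \sum_i `|d i|.
have bnd y : eigenvalue A y -> - K <= y <= K.
  move=> /eigenvalueP[v vA v0].
  have u0 : v^T != 0 by rewrite trmx_eq0.
  have [w [w0 sw /(_ 'X)]] := spec v^T.
  rewrite horner_mx_X trmxK vA -scalemxAl mxE.
  have -> : (v *m v^T) 0 0 = sqnorm v^T by rewrite sqnormE trmxK.
  have := sqnorm_gt0 u0; have -> : sqnorm v^T = \sum_i w i by rewrite sw.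
  move=> s0 E.
  have dK i : `|d i| <= K.
    by rewrite /K (bigD1 i) //= lerDl sumr_ge0.
  rewrite -[y <= K](ler_pM2r s0) -[- K <= y](ler_pM2r s0) E !mulr_sumr.
  apply/andP; split; apply: ler_sum => i _; rewrite hornerX ler_wpM2r //.
    by rewrite lerNl (le_trans _ (dK i)) // -normrN ler_norm.
  by rewrite (le_trans (ler_norm _)).
apply/andP; split.
  apply: ge_inf => //; exists (- K) => y /= /bnd /andP[] //.
apply: ub_le_sup => //; exists K => y /= /bnd /andP[] //.
Qed.

Lemma exists_interpolation (s : seq R) (f : R -> R) :
  exists q : {poly R}, forall x, x \in s -> q.[x] = f x.
Proof.
elim: s => [|x s [q qP]]; first by exists 0.
have [xs|xs] := boolP (x \in s).
  by exists q => y; rewrite inE => /orP[/eqP->|]; apply: qP.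
(* A correction at x that vanishes at the points already treated. *)
pose r := \prod_(y <- s) ('X - y%:P).
have rx : r.[x] != 0 by rewrite -[_ == 0]/(root r x) root_prod_XsubC.
exists (q + ((f x - q.[x]) / r.[x]) *: r) => y.
rewrite inE hornerD hornerZ => /orP[/eqP->|ys].
  by rewrite divfK // addrC subrK.
have : root r y by rewrite root_prod_XsubC.
by move=> /eqP ->; rewrite mulr0 addr0 qP.
Qed.

Lemma sym_posdef_eigenvalue_gt0 n (A : 'M[R]_n) x :
  sym_posdef A -> eigenvalue A x -> 0 < x.
Proof.
move=> [symA posA] /eigenvalueP[v vA v0].
have u0 : v^T != 0 by rewrite trmx_eq0.
have := posA _ u0; rewrite trmxK vA -scalemxAl mxE.
have -> : (v *m v^T) 0 0 = sqnorm v^T by rewrite sqnormE trmxK.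
by rewrite pmulr_lgt0 // sqnorm_gt0.
Qed.

Lemma sym_posdef_unitmx n (A : 'M[R]_n) : sym_posdef A -> A \in unitmx.
Proof.
move=> pA; rewrite -row_free_unit -kermx_eq0; apply/negPn/negP => k0.
have : eigenvalue A 0.
  by rewrite /eigenvalue /eigenspace raddf0 subr0.
by move/(sym_posdef_eigenvalue_gt0 pA); rewrite ltxx.
Qed.

(** The square root is a polynomial in the matrix, one that interpolates the
    square roots of the eigenvalues; a polynomial in a symmetric matrix is
    symmetric. *)
Lemma sym_posdef_mxsqrt n (A : 'M[R]_n) :
  sym_posdef A -> sym_posdef (mxsqrt A) /\ mxsqrt A *m mxsqrt A = A.
Proof.
move=> pA; suff [Q QP] : exists Q, [set Q | sym_posdef Q /\ Q *m Q = A] Q.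
  exact: (@xgetPex _ 0 _ (ex_intro _ Q QP)).
case: n A pA => [|n] A pA.
  by exists A; split => //; apply/matrixP; case.
have [symA _] := pA.
have [d [eigd ann spec]] := symmetric_spectral symA.
have d0 i : 0 < d i by apply: sym_posdef_eigenvalue_gt0 pA (eigd i).
have [q qP] := exists_interpolation [seq d i | i <- enum 'I_n.+1] (@Num.sqrt R).
have qd i : q.[d i] = Num.sqrt (d i) by apply: qP; rewrite map_f // mem_enum.
exists (horner_mx A q); split; first split.
- have symX k : (A ^+ k)^T = A ^+ k.
    elim: k => [|k IH]; first by rewrite expr0 trmx1.
    by rewrite exprS trmx_mul IH symA -[LHS]/(A ^+ k * A) -exprSr exprS.
  rewrite -[q in LHS]coefK -[q in RHS]coefK poly_def !rmorph_sum /= raddf_sum.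
  apply: eq_bigr => i _; rewrite horner_mxZ rmorphXn /= horner_mx_X.
  by rewrite linearZ /= symX.
- move=> v v0; have [w [w0 sw ->]] := spec v.
  have s0 : 0 < \sum_i w i by rewrite sw; apply: sqnorm_gt0.
  have t0 i : 0 <= q.[d i] * w i by rewrite qd mulr_ge0 ?sqrtr_ge0.
  rewrite lt_def sumr_ge0 ?andbT //; apply: contraTN s0 => /eqP s0.
  rewrite -leNgt big1 // => i _.
  have /eqP := psumr_eq0P (fun i _ => t0 i) s0 (erefl true : xpredT i).
  by rewrite mulf_eq0 qd sqrtr_eq0 leNgt d0 /= => /eqP.
- apply/eqP; rewrite -subr_eq0; apply/eqP.
  have := ann (q * q - 'X).
  rewrite rmorphB rmorphM /= horner_mx_X; apply=> i.
  by rewrite !hornerE qd -expr2 sqr_sqrtr ?subrr // ltW.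
Qed.

(** The vector is [A^(-1/2) v]; the square root being symmetric, it can be
    moved across the transposition. *)
Lemma sym_posdef_whitening n (A : 'M[R]_n) (v : 'cV[R]_n) :
  sym_posdef A ->
  exists2 a : 'cV[R]_n, v^T *m invmx (mxsqrt A) = a^T
    & (a^T *m A *m a) 0 0 = sqnorm v.
Proof.
move=> pA; have [pQ QQ] := sym_posdef_mxsqrt pA.
have Qu := sym_posdef_unitmx pQ; have [symQ _] := pQ.
exists (invmx (mxsqrt A) *m v); first by rewrite trmx_mul trmx_inv symQ.
rewrite trmx_mul trmx_inv symQ -{2}QQ sqnormE !mulmxA mulmxKV //.
by rewrite -!mulmxA mulKVmx // .
Qed.

End quadratic_forms.

(** * Measurability of matrix-valued maps *)

Section measurable_matrices.
Context d (T : measurableType d) (R : realType).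

Lemma measurable_mx_cst a b (M : 'M[R]_(a, b)) : measurable_mx (fun _ : T => M).
Proof. by move=> i j; exact: measurable_cst. Qed.

Lemma measurable_mxD a b (M N : T -> 'M[R]_(a, b)) :
  measurable_mx M -> measurable_mx N -> measurable_mx (fun w => M w + N w).
Proof.
move=> mM mN i j; apply: (eq_measurable_fun (fun w => M w i j + N w i j)).
  by move=> w _; rewrite mxE.
exact: measurable_funD.
Qed.

Lemma measurable_mxN a b (M : T -> 'M[R]_(a, b)) :
  measurable_mx M -> measurable_mx (fun w => - M w).
Proof.
move=> mM i j; apply: (eq_measurable_fun (fun w => - M w i j)).
  by move=> w _; rewrite mxE.
exact: measurable_funN.
Qed.

Lemma measurable_mx_mul a b c (M : T -> 'M[R]_(a, b)) (N : T -> 'M[R]_(b, c)) :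
  measurable_mx M -> measurable_mx N -> measurable_mx (fun w => M w *m N w).
Proof.
move=> mM mN i j; apply: (eq_measurable_fun (fun w => \sum_k M w i k * N w k j)).
  by move=> w _; rewrite mxE.
by apply: measurable_sum => k; apply: measurable_funM.
Qed.

Lemma measurable_mx_sum (I : Type) (r : seq I) a b (M : I -> T -> 'M[R]_(a, b)) :
  (forall k, measurable_mx (M k)) -> measurable_mx (fun w => \sum_(k <- r) M k w).
Proof.
move=> mM i j; apply: (eq_measurable_fun (fun w => \sum_(k <- r) M k w i j)).
  by move=> w _; rewrite summxE.
by apply: measurable_sum => k; apply: mM.
Qed.

Lemma measurable_det a (M : T -> 'M[R]_a) :
  measurable_mx M -> measurable_fun setT (fun w => \det (M w)).
Proof.
move=> mM; apply: measurable_sum => s; apply: measurable_funM.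
  exact: measurable_cst.
by apply: measurable_prod => i _; apply: mM.
Qed.

Lemma measurable_adj a (M : T -> 'M[R]_a) :
  measurable_mx M -> measurable_mx (fun w => \adj (M w)).
Proof.
move=> mM i j; apply: (eq_measurable_fun (fun w => cofactor (M w) j i)).
  by move=> w _; rewrite mxE.
apply: measurable_funM; first exact: measurable_cst.
apply: measurable_det => k l.
apply: (eq_measurable_fun (fun w => M w (lift j k) (lift i l))); last exact: mM.
by move=> w _; rewrite !mxE.
Qed.

(** Inversion is continuous off 0, and the point 0 is treated apart. *)
Lemma measurable_realV : measurable_fun setT (fun x : R => x^-1).
Proof.
apply: (eq_measurable_fun (fun x : R => if x == 0 then 0 else x^-1)).
  by move=> x _; case: eqP => // ->; rewrite invr0.
apply: measurable_fun_if => //.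
- by apply: measurable_fun_eqr; [exact: measurable_id | exact: measurable_cst].
- have h : measurable_fun [set~ (0:R)] (fun x : R => x^-1).
    apply: open_continuous_measurable_fun.
      by apply: closed_openC; apply: accessible_closed_set1; apply: hausdorff_accessible; exact: Rhausdorff.
    by move=> x; rewrite inE /= => /eqP x0; apply: inv_continuous.
  apply: measurable_funS h; first exact: measurableC.
  by move=> x /= [_ /negbT /eqP].
Qed.

(** By the cofactor formula on invertible matrices; singular matrices are fixed
    by the inversion. *)
Lemma measurable_invmx a (M : T -> 'M[R]_a) :
  measurable_mx M -> measurable_mx (fun w => invmx (M w)).
Proof.
move=> mM i j.
apply: (eq_measurable_fun (fun w => if \det (M w) == 0 then M w i j
   else (\det (M w))^-1 * (\adj (M w)) i j)).
  move=> w _; rewrite /invmx unitmxE unitfE; case: eqP => //= _.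
  by rewrite [RHS]mxE.
apply: measurable_fun_ifT.
- by apply: measurable_fun_eqr; [exact: measurable_det | exact: measurable_cst].
- exact: mM.
- apply: measurable_funM; last exact: measurable_adj.
  by apply: (measurableT_comp measurable_realV); apply: measurable_det.
Qed.

Lemma measurable_fnorm a b (M : T -> 'M[R]_(a, b)) :
  measurable_mx M -> measurable_fun setT (fun w => fnorm (M w)).
Proof.
move=> mM; apply: (measurableT_comp (continuous_measurable_fun (@sqrt_continuous R))).
apply: measurable_sum => i; apply: measurable_sum => j.
by apply: measurable_funX; apply: mM.
Qed.

Lemma measurable_mx_eq0 a b (M : T -> 'M[R]_(a, b)) :
  measurable_mx M -> measurable [set w | M w = 0].
Proof.
move=> mM; have -> : [set w | M w = 0] =
    \bigcap_(u in [set: 'I_a * 'I_b]) ((fun w => M w u.1 u.2) @^-1` [set 0]).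
  apply/seteqP; split => [w /= M0 u _ /=|w h]; first by rewrite M0 mxE.
  by apply/matrixP => i j; rewrite mxE; exact: (h (i, j)).
apply: fin_bigcap_measurable => // u _.
by rewrite -[X in measurable X]setTI; apply: mM.
Qed.

Variables (m p : nat) (X : 'M[R]_(m, p)) (beta : T -> 'cV[R]_p).
Hypothesis mbeta : measurable_mx beta.

Lemma measurable_logistic : measurable_fun setT (@logistic R).
Proof.
apply: measurable_funM; first exact: measurable_expR.
apply: (measurableT_comp measurable_realV).
by apply: measurable_funD; [exact: measurable_cst | exact: measurable_expR].
Qed.

Lemma measurable_prob_vec : measurable_mx (fun w => prob_vec X (beta w)).
Proof.
move=> i j; apply: (eq_measurable_fun (fun w => logistic ((X *m beta w) i 0))).
  by move=> w _; rewrite [RHS]mxE.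
apply: (measurableT_comp measurable_logistic).
by apply: measurable_mx_mul => //; apply: measurable_mx_cst.
Qed.

Lemma measurable_sqrt_binvar j :
  measurable_fun setT (fun w => Num.sqrt (binvar X (beta w) j)).
Proof.
apply: (measurableT_comp (continuous_measurable_fun (@sqrt_continuous R))).
apply: measurable_funM; first exact: measurable_prob_vec.
by apply: measurable_funB; [exact: measurable_cst | exact: measurable_prob_vec].
Qed.

Lemma measurable_diag_mx (D : 'I_m -> T -> R) :
  (forall j, measurable_fun setT (D j)) ->
  measurable_mx (fun w => diag_mx (\row_j D j w)).
Proof.
move=> mD i j; apply: (eq_measurable_fun (fun w => D i w *+ (i == j))).
  by move=> w _; rewrite !mxE.
by case: (i == j); [exact: mD | exact: measurable_cst].
Qed.

Lemma measurable_A_half : measurable_mx (fun w => A_half X (beta w)).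
Proof. by apply: measurable_diag_mx => j; apply: measurable_sqrt_binvar. Qed.

Lemma measurable_A_mhalf : measurable_mx (fun w => A_mhalf X (beta w)).
Proof.
apply: measurable_diag_mx => j.
by apply: (measurableT_comp measurable_realV); apply: measurable_sqrt_binvar.
Qed.

End measurable_matrices.

Lemma measurable_score d (T : measurableType d) (R : realType) (n m p : nat)
    (X : 'I_n -> 'M[R]_(m, p)) (Y : 'I_n -> T -> 'cV[R]_m) (Rhat : T -> 'M[R]_m)
    (beta : T -> 'cV[R]_p) :
  (forall i, measurable_mx (Y i)) -> measurable_mx Rhat -> measurable_mx beta ->
  measurable_mx (fun w => score X (fun i => Y i w) (Rhat w) (beta w)).
Proof.
move=> mY mR mb; apply: measurable_mx_sum => i.
apply: measurable_mx_mul; last first.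
  by apply: measurable_mxD => //; apply: measurable_mxN; apply: measurable_prob_vec.
apply: measurable_mx_mul; last exact: measurable_A_mhalf.
apply: measurable_mx_mul; last exact: measurable_invmx.
by apply: measurable_mx_mul; [exact: measurable_mx_cst | exact: measurable_A_half].
Qed.

(** * The logistic function under a shift of its argument *)

Section logistic_perturbation.
Variable R : realType.
Implicit Types (s h u x : R).

Lemma expR_linear_bound x : `|x| <= 2^-1 -> `|expR x - 1 - x| <= 2 * x ^+ 2.
Proof.
move=> x1; have l := expR_ge1Dx x; have l' := expR_ge1Dx (- x).
have x0 := expR_gt0 x.
have e : expR (- x) * expR x = 1 by rewrite mulrC expRxMexpNx_1.
have e1 : (1 - x) * expR x <= 1 by rewrite -[leRHS]e ler_wpM2r // ltW.
move: x1; rewrite ler_norml => /andP[a b].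
have u : expR x <= 1 + x + 2 * x ^+ 2.
  rewrite -(@ler_pM2l _ (1 - x)); last by lra.
  apply: le_trans e1 _.
  have : 0 <= x ^+ 2 * (1 - 2 * x) by rewrite mulr_ge0 ?sqr_ge0 //; lra.
  nra.
rewrite ler_norml; have sx := sqr_ge0 x; apply/andP; split; lra.
Qed.

(** With [s = logistic u], the square root of [logistic' u / logistic' (u +
    h)]: the factor by which the standard deviation of a binary variable is
    divided when the linear predictor moves from [u] to [u + h]. Being a
    mixture of two exponentials it is easy to expand, and its inverse never has
    to be. *)
Definition tilt s h : R := (1 - s) * expR (- (h / 2)) + s * expR (h / 2).
(** This is [2 sinh (h / 2)]. *)
Definition two_sinh_half h : R := expR (h / 2) - expR (- (h / 2)).
(** With [s = logistic u], this is [logistic (u + h) - logistic u]. *)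
Definition logistic_incr s h : R := s * (1 - s) * two_sinh_half h / tilt s h.

Lemma tilt_gt0 s h : 0 < s < 1 -> 0 < tilt s h.
Proof.
move=> /andP[s0 s1]; have := expR_gt0 (h / 2); have := expR_gt0 (- (h / 2)).
by move=> a b; rewrite addr_gt0 // mulr_gt0 // subr_gt0.
Qed.

Lemma logistic_itv u : 0 < logistic u < 1.
Proof.
have e := expR_gt0 u; have d : 0 < 1 + expR u by rewrite addr_gt0.
by rewrite /logistic divr_gt0 //= ltr_pdivrMr // mul1r ltrDr.
Qed.

(** Both sides are rational functions of [exp u] and [exp (h / 2)]. *)
Lemma logisticD u h :
  logistic (u + h) = logistic u + logistic_incr (logistic u) h.
Proof.
have t0 := tilt_gt0 h (logistic_itv u).
have e := expR_gt0 u; have d : 0 < 1 + expR u by rewrite addr_gt0.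
move: t0; rewrite /logistic_incr /tilt /two_sinh_half /logistic.
have -> : expR (u + h) = expR u * expR (h / 2) ^+ 2.
  by rewrite -expRM_natl -expRD; congr expR; field.
rewrite expRN; have f := expR_gt0 (h / 2).
move: (expR u) (expR (h / 2)) e f d => U H U0 H0 d t0.
have d2 : 0 < 1 + U * H ^+ 2 by rewrite addr_gt0 // mulr_gt0 // exprn_gt0.
have -> : (1 - U / (1 + U)) * H^-1 + U / (1 + U) * H = (1 + U * H ^+ 2) / ((1 + U) * H).
  by field; rewrite !gt_eqF.
by field; rewrite !gt_eqF.
Qed.

Lemma logistic_varD u h :
  logistic (u + h) * (1 - logistic (u + h)) =
    logistic u * (1 - logistic u) / tilt (logistic u) h ^+ 2.
Proof.
have t0 := tilt_gt0 h (logistic_itv u).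
have e := expR_gt0 u; have d : 0 < 1 + expR u by rewrite addr_gt0.
move: t0; rewrite /tilt /logistic.
have -> : expR (u + h) = expR u * expR (h / 2) ^+ 2.
  by rewrite -expRM_natl -expRD; congr expR; field.
rewrite expRN; have f := expR_gt0 (h / 2).
move: (expR u) (expR (h / 2)) e f d => U H U0 H0 d t0.
have d2 : 0 < 1 + U * H ^+ 2 by rewrite addr_gt0 // mulr_gt0 // exprn_gt0.
have -> : (1 - U / (1 + U)) * H^-1 + U / (1 + U) * H = (1 + U * H ^+ 2) / ((1 + U) * H).
  by field; rewrite !gt_eqF.
by field; rewrite !gt_eqF.
Qed.

Lemma sqrt_logistic_varD u h :
  Num.sqrt (logistic (u + h) * (1 - logistic (u + h))) =
    Num.sqrt (logistic u * (1 - logistic u)) / tilt (logistic u) h.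
Proof.
have t0 := tilt_gt0 h (logistic_itv u).
have /andP[s0 s1] := logistic_itv u.
rewrite logistic_varD sqrtrM; last by rewrite mulr_ge0 ?subr_ge0 ?(ltW s0) ?(ltW s1).
by rewrite sqrtrV ?sqr_ge0 // sqrtr_sqr ger0_norm // ltW.
Qed.

Lemma half_norm h : `|h| <= 2^-1 -> `|h / 2| <= 2^-1 /\ `|- (h / 2)| <= 2^-1.
Proof.
by rewrite !ler_norml => /andP[? ?]; split; apply/andP; split; lra.
Qed.

Lemma tilt_linear s h : 0 < s < 1 -> `|h| <= 2^-1 ->
  `|tilt s h - 1 - (s - 2^-1) * h| <= h ^+ 2 / 2.
Proof.
move=> /andP[s0 s1] hs; have [h1 h2] := half_norm hs.
have := expR_linear_bound h1; have := expR_linear_bound h2.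
rewrite /tilt; move: (expR (- (h / 2))) (expR (h / 2)) => a b.
rewrite !ler_norml => /andP[a1 a2] /andP[b1 b2].
have -> : (1 - s) * a + s * b - 1 - (s - 2^-1) * h =
  (1 - s) * (a - 1 - - (h / 2)) + s * (b - 1 - h / 2) by field.
have q : (- (h / 2)) ^+ 2 = (h / 2) ^+ 2 by rewrite sqrrN.
rewrite q in a1 a2.
have E : h ^+ 2 / 2 = (1 - s) * (2 * (h / 2) ^+ 2) + s * (2 * (h / 2) ^+ 2) by field.
by rewrite E; apply/andP; split; [rewrite opprD -!mulrN|]; apply: lerD; apply: ler_wpM2l => //; lra.
Qed.

Lemma two_sinh_half_linear h : `|h| <= 2^-1 -> `|two_sinh_half h - h| <= h ^+ 2.
Proof.
move=> hs; have [h1 h2] := half_norm hs.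
have := expR_linear_bound h1; have := expR_linear_bound h2.
rewrite /two_sinh_half sqrrN expr_div_n; move: (expR (- (h / 2))) (expR (h / 2)) => a b.
rewrite !ler_norml => /andP[a1 a2] /andP[b1 b2].
by apply/andP; split; lra.
Qed.

Lemma tilt_near1 s h : 0 < s < 1 -> `|h| <= 2^-1 -> `|1 - tilt s h| <= `|h|.
Proof.
move=> s01 hs; have := tilt_linear s01 hs; have /andP[s0 s1] := s01.
move: (tilt s h) => t B.
have c : `|(s - 2^-1) * h| <= 2^-1 * `|h|.
  by rewrite normrM ler_wpM2r // ler_norml; apply/andP; split; lra.
have d : h ^+ 2 / 2 <= 2^-1 * `|h|.
  by rewrite -real_normK ?num_real //; have := normr_ge0 h; nra.
have -> : 1 - t = - ((t - 1 - (s - 2^-1) * h) + (s - 2^-1) * h) by ring.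
rewrite normrN (le_trans (ler_normD _ _)) //; lra.
Qed.

Lemma tilt_ge_half s h : 0 < s < 1 -> `|h| <= 2^-1 -> 2^-1 <= tilt s h.
Proof.
move=> s01 hs; have := tilt_near1 s01 hs; move: (tilt s h) => t.
by move=> /le_trans /(_ hs); rewrite ler_norml => /andP[? ?]; lra.
Qed.

Lemma logistic_incr_linear s h : 0 < s < 1 -> `|h| <= 2^-1 ->
  `|logistic_incr s h - s * (1 - s) * h| <= h ^+ 2.
Proof.
move=> s01 hs; have B := two_sinh_half_linear hs; have T := tilt_near1 s01 hs.
have t2 := tilt_ge_half s01 hs; have /andP[s0 s1] := s01.
rewrite /logistic_incr; move: (tilt s h) (two_sinh_half h) t2 B T => t v t2 B T.
have t0 : 0 < t by apply: lt_le_trans t2.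
have -> : s * (1 - s) * v / t - s * (1 - s) * h =
   s * (1 - s) * (((v - h) + h * (1 - t)) / t) by field; rewrite gt_eqF.
have q : s * (1 - s) <= 4^-1 by have := sqr_ge0 (s - 2^-1); nra.
have q0 : 0 <= s * (1 - s) by rewrite mulr_ge0 ?subr_ge0 ?(ltW s0) ?(ltW s1).
rewrite normrM (ger0_norm q0).
have n : `|(v - h) + h * (1 - t)| <= 2 * h ^+ 2.
  rewrite (le_trans (ler_normD _ _)) // normrM.
  have : `|h| * `|1 - t| <= h ^+ 2.
    by rewrite -[h ^+ 2]real_normK ?num_real // expr2 ler_wpM2l.
  lra.
have m : `|((v - h) + h * (1 - t)) / t| <= 4 * h ^+ 2.
  rewrite normrM normfV (ger0_norm (ltW t0)) ler_pdivrMr // (le_trans n) //.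
  have := sqr_ge0 h; nra.
by apply: le_trans (ler_pM q0 (normr_ge0 _) q m) _; rewrite mulrA mulVf // mul1r.
Qed.

(** The ratio of two standard deviations at the estimate over the same ratio at
    the true parameter, to first order in the shifts. *)
Lemma tilt_ratio_linear s h s' h' : 0 < s < 1 -> 0 < s' < 1 ->
  `|h| <= 2^-1 -> `|h'| <= 2^-1 ->
  `|tilt s' h' / tilt s h - 1 - ((s' - 2^-1) * h' - (s - 2^-1) * h)|
    <= 3 * (h ^+ 2 + h' ^+ 2).
Proof.
move=> s01 s01' hs hs'.
have B := tilt_linear s01 hs; have B' := tilt_linear s01' hs'.
have T := tilt_near1 s01 hs.
have t2 := tilt_ge_half s01 hs.
have t0 : 0 < tilt s h by apply: lt_le_trans t2.
have /andP[s0 s1] := s01; have /andP[s0' s1'] := s01'.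
move: (tilt s h) (tilt s' h') t0 t2 T B B' => t t' t0 t2 T B B'.
set L := (s' - 2^-1) * h' - (s - 2^-1) * h.
have BL : `|L| <= 2^-1 * (`|h| + `|h'|).
  rewrite /L (le_trans (ler_normB _ _)) // !normrM addrC mulrDr lerD //.
    by rewrite ler_wpM2r // ler_norml; apply/andP; split; lra.
  by rewrite ler_wpM2r // ler_norml; apply/andP; split; lra.
have -> : t' / t - 1 - L = ((t' - 1 - (s' - 2^-1) * h') - (t - 1 - (s - 2^-1) * h)
   + L * (1 - t)) / t by rewrite /L; field; rewrite gt_eqF.
rewrite normrM normfV (ger0_norm (ltW t0)) ler_pdivrMr //.
have LT : `|L * (1 - t)| <= 2^-1 * (`|h| + `|h'|) * `|h| by rewrite normrM ler_pM.
rewrite (le_trans (ler_normD _ _)) // (le_trans (lerD (ler_normB _ _) (lexx _))) //.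
rewrite -[h ^+ 2]real_normK ?num_real // -[h' ^+ 2]real_normK ?num_real //.
rewrite -[h ^+ 2]real_normK ?num_real // -[h' ^+ 2]real_normK ?num_real // in B B'.
move: (normr_ge0 h) (normr_ge0 h') B B' LT; move: `|h| `|h'| => p q.
move: `|_ - _| `|_ - _| `|_ * _| => A A' C p0 q0 b b' lt.
have : 0 <= (3 * (p ^+ 2 + q ^+ 2)) * (t - 2^-1).
  by rewrite mulr_ge0 ?subr_ge0 // mulr_ge0 // addr_ge0 ?sqr_ge0.
have := sqr_ge0 (p - q); nra.
Qed.

End logistic_perturbation.

(** * Linearization of the weighted residuals *)

Section linearization.
Variable R : realType.

(** The score term at the estimate, [V * r * (e - logistic_incr s' h')],
    against its expansion: the term at the true parameter with the limit
    correlation [Vb], and the two first-order terms that are linear in the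
    residual [e]. What is left is quadratic in the shifts [h] and [h'], or the
    error [kap] of the working correlation times a shift. *)
Lemma score_term_bound (s h s' h' V Vb e eta kap v L r : R) :
  0 < s < 1 -> 0 < s' < 1 -> `|h| <= eta -> `|h'| <= eta -> eta <= 2^-1 ->
  `|V| <= v -> `|V - Vb| <= kap -> `|e| <= 1 ->
  L = (s' - 2^-1) * h' - (s - 2^-1) * h ->
  r = tilt s' h' / tilt s h ->
  `|Vb * (e - s' * (1 - s') * h') - V * r * (e - logistic_incr s' h')
     + V * L * e + (V - Vb) * e| <= (12 * v * eta + kap) * (`|h| + `|h'|).
Proof.
move=> s01 s01' hs hs' eta1 Vv Vk e1 LE rE.
have hh := le_trans hs eta1; have hh' := le_trans hs' eta1.
have Br := tilt_ratio_linear s01 s01' hh hh'.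
have Bd := logistic_incr_linear s01' hh'.
rewrite -LE -rE in Br.
have /andP[s0 s1] := s01; have /andP[s0' s1'] := s01'.
have BL : `|L| <= 2^-1 * (`|h| + `|h'|).
  rewrite LE (le_trans (ler_normB _ _)) // !normrM addrC mulrDr lerD //.
    by rewrite ler_wpM2r // ler_norml; apply/andP; split; lra.
  by rewrite ler_wpM2r // ler_norml; apply/andP; split; lra.
set q := s' * (1 - s') in Bd *.
have q0 : 0 <= q by rewrite mulr_ge0 ?subr_ge0 ?(ltW s0') ?(ltW s1').
have q4 : q <= 4^-1 by rewrite /q; have := sqr_ge0 (s' - 2^-1); nra.
clearbody q.
move: (logistic_incr s' h') Bd => D Bd; clear LE rE.
set S := `|h| + `|h'| in BL *.
have S0 : 0 <= S by rewrite addr_ge0.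
have S1 : S <= 1 by rewrite /S; lra.
have hS : h ^+ 2 + h' ^+ 2 <= eta * S.
  rewrite -[h ^+ 2]real_normK ?num_real // -[h' ^+ 2]real_normK ?num_real //.
  by rewrite /S mulrDr !expr2 lerD // ler_wpM2r.
have eta0 : 0 <= eta := le_trans (normr_ge0 _) hs.
have v0 : 0 <= v := le_trans (normr_ge0 _) Vv.
have h'S : h' ^+ 2 <= eta * S by apply: le_trans hS; rewrite lerDr sqr_ge0.
have hS1 : h ^+ 2 + h' ^+ 2 <= 2^-1 * S by rewrite (le_trans hS) // ler_wpM2r.
have Br1 : `|r - 1| <= 2 * S.
  have -> : r - 1 = (r - 1 - L) + L by ring.
  rewrite (le_trans (ler_normD _ _)) //; lra.
have Br2 : `|r| <= 3.
  have -> : r = (r - 1) + 1 by ring.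
  rewrite (le_trans (ler_normD _ _)) // normr1; lra.
have h'S2 : `|h'| <= S by rewrite /S lerDr.
have -> : Vb * (e - q * h') - V * r * (e - D) + V * L * e + (V - Vb) * e =
  (V * (r * (D - q * h') + (r - 1) * (q * h') - (r - 1 - L) * e))
   + (V - Vb) * (q * h') by ring.
rewrite (le_trans (ler_normD _ _)) // [leRHS]mulrDl lerD //; last first.
  rewrite normrM ler_pM // normrM (ger0_norm q0).
  by apply: le_trans h'S2; rewrite ler_piMl //; lra.
have -> : 12 * v * eta * S = v * (12 * (eta * S)) by ring.
rewrite normrM ler_pM //.
have t1 : `|r * (D - q * h')| <= 3 * (eta * S).
  by rewrite normrM ler_pM // (le_trans Bd).
have t2 : `|(r - 1) * (q * h')| <= 2 * S * (4^-1 * eta).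
  rewrite normrM ler_pM // normrM (ger0_norm q0).
  by rewrite ler_pM.
have t3 : `|(r - 1 - L) * e| <= 3 * (eta * S).
  rewrite normrM -[leRHS]mulr1 ler_pM // (le_trans Br) // ler_wpM2l //.
have etaS : 0 <= eta * S by rewrite mulr_ge0.
rewrite (le_trans (ler_normB _ _)) // (le_trans (lerD (ler_normD _ _) (lexx _))) //.
lra.
Qed.

Variables n m : nat.
Implicit Types (x h s e : 'I_n -> 'I_m -> R) (V Vb : 'M[R]_m).

Definition triple_sum (f : 'I_n -> 'I_m -> 'I_m -> R) : R :=
  \sum_i \sum_j \sum_k f i j k.

Lemma triple_sumD f g :
  triple_sum (fun i j k => f i j k + g i j k) = triple_sum f + triple_sum g.
Proof.
rewrite -big_split; apply: eq_bigr => i _; rewrite -big_split.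
by apply: eq_bigr => j _; rewrite -big_split.
Qed.

Lemma triple_sumZ c f : triple_sum (fun i j k => c * f i j k) = c * triple_sum f.
Proof.
rewrite /triple_sum mulr_sumr; apply: eq_bigr => i _; rewrite mulr_sumr.
by apply: eq_bigr => j _; rewrite mulr_sumr.
Qed.

Lemma triple_sum_le f g : (forall i j k, f i j k <= g i j k) ->
  triple_sum f <= triple_sum g.
Proof. by move=> fg; do 3 (apply: ler_sum => ? _). Qed.

Lemma triple_sum_norm_le f g : (forall i j k, `|f i j k| <= g i j k) ->
  `|triple_sum f| <= triple_sum g.
Proof.
move=> fg; apply: (le_trans (ler_norm_sum _ _ _)); apply: ler_sum => i _.
apply: (le_trans (ler_norm_sum _ _ _)); apply: ler_sum => j _.
by apply: (le_trans (ler_norm_sum _ _ _)); apply: ler_sum => k _.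
Qed.

(** The hypothesis that a triple sum vanishes is the estimating equation in the
    direction [a]. The last two terms of the bound are kept as sums: they are
    linear in the residuals, and taking absolute values inside them would lose
    the cancellation between clusters. *)
Lemma score_linearization x h s e V Vb (c : 'I_n -> 'I_m -> 'I_m -> R) eta kap v c0 :
  (forall i j, 0 < s i j < 1) -> (forall i j, `|h i j| <= eta) -> eta <= 2^-1 ->
  (forall j k, `|V j k| <= v) -> (forall j k, `|V j k - Vb j k| <= kap) ->
  (forall i j, `|e i j| <= 1) -> (forall i j k, `|c i j k| <= c0) ->
  triple_sum (fun i j k => x i j * c i j k * (V j k *
     (tilt (s i k) (h i k) / tilt (s i j) (h i j)) *
     (e i k - logistic_incr (s i k) (h i k)))) = 0 ->
  `|triple_sum (fun i j k => x i j * c i j k *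
       (Vb j k * (e i k - s i k * (1 - s i k) * h i k)))|
  <= c0 * (12 * v * eta + kap) *
       triple_sum (fun i j k => `|x i j| * (`|h i j| + `|h i k|))
   + `|triple_sum (fun i j k => x i j * c i j k * (V j k *
        ((s i k - 2^-1) * h i k - (s i j - 2^-1) * h i j) * e i k))|
   + `|triple_sum (fun i j k => x i j * c i j k * ((V j k - Vb j k) * e i k))|.
Proof.
move=> s01 hs eta1 Vv Vk e1 cc0 root.
set A := triple_sum (fun i j k => _ * (Vb j k * _)).
set B := triple_sum (fun i j k => _ * (V j k * _ * _)).
set C := triple_sum (fun i j k => _ * ((V j k - _) * _)).
set Z := triple_sum _ in root.
have -> : A = (A - Z + B + C) - B - C by rewrite root; ring.
have E : A - Z + B + C = triple_sum (fun i j k => x i j * c i j k *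
  (Vb j k * (e i k - s i k * (1 - s i k) * h i k) - V j k *
     (tilt (s i k) (h i k) / tilt (s i j) (h i j)) *
     (e i k - logistic_incr (s i k) (h i k)) + V j k *
        ((s i k - 2^-1) * h i k - (s i j - 2^-1) * h i j) * e i k
    + (V j k - Vb j k) * e i k)).
  rewrite -[- Z]mulN1r -triple_sumZ -!triple_sumD.
  by do 3 (apply: eq_bigr => ? _); ring.
apply: (le_trans (ler_normB _ _)); rewrite lerD //.
apply: (le_trans (ler_normB _ _)); rewrite lerD // E -triple_sumZ.
apply: triple_sum_norm_le => i j k.
have T := score_term_bound (s01 i j) (s01 i k) (hs i j) (hs i k) eta1 (Vv j k)
  (Vk j k) (e1 i k) erefl erefl.
rewrite !normrM.
have -> : c0 * (12 * v * eta + kap) * (`|x i j| * (`|h i j| + `|h i k|)) =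
  `|x i j| * c0 * ((12 * v * eta + kap) * (`|h i j| + `|h i k|)) by ring.
by rewrite ler_pM // ?mulr_ge0 // ler_wpM2l.
Qed.

End linearization.

(** * The estimating function along a direction *)

Section estimating_equation.
Variable R : realType.

(** From [sum (V u - A v)^2 >= 0] with [V = sum v^2] and [A = sum u v]. *)
Lemma cauchy_schwarz_sum (I : finType) (u v : I -> R) :
  (\sum_i u i * v i) ^+ 2 <= (\sum_i u i ^+ 2) * (\sum_i v i ^+ 2).
Proof.
set A := \sum_i u i * v i; set U := \sum_i u i ^+ 2; set V := \sum_i v i ^+ 2.
have V0 : 0 <= V by apply: sumr_ge0 => i _; rewrite sqr_ge0.
have : 0 <= \sum_i (V * u i - A * v i) ^+ 2 by apply: sumr_ge0 => i _; rewrite sqr_ge0.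
have -> : \sum_i (V * u i - A * v i) ^+ 2 = V * (V * U - A ^+ 2).
  transitivity (\sum_i (V ^+ 2 * u i ^+ 2 + (- 2 * V * A) * (u i * v i) + A ^+ 2 * v i ^+ 2)).
    by apply: eq_bigr => i _; ring.
  rewrite !big_split /= -!mulr_sumr -/A -/U -/V; ring.
have [V00|V0'] := eqVneq V 0.
  have v0 i : v i = 0.
    apply/eqP; rewrite -sqrf_eq0; apply/eqP.
    by apply: (psumr_eq0P _ V00) => // j _; rewrite sqr_ge0.
  by move=> _; rewrite /A big1 ?expr0n ?V00 ?mulr0 // => i _; rewrite v0 mulr0.
by rewrite pmulr_rge0 ?lt_def ?V0' // subr_ge0 mulrC.
Qed.

Lemma diag_form_sum m (u w : 'cV[R]_m) (D1 D2 : 'I_m -> R) (V : 'M[R]_m) :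
  (u^T *m diag_mx (\row_j D1 j) *m V *m diag_mx (\row_j D2 j) *m w) 0 0 =
  \sum_j \sum_k u j 0 * D1 j * V j k * D2 k * w k 0.
Proof.
rewrite mxE exchange_big /=; apply: eq_bigr => k _.
rewrite mul_mx_diag 2!mxE [in X in _ * X * _]mxE !big_distrl /=; apply: eq_bigr => j _.
by rewrite mul_mx_diag !mxE.
Qed.

Lemma prob_vecE m p (Z : 'M[R]_(m, p)) (b : 'cV[R]_p) j :
  prob_vec Z b j 0 = logistic ((Z *m b) j 0).
Proof. by rewrite mxE. Qed.

Variables (n m p : nat) (X : 'I_n -> 'M[R]_(m, p)) (beta0 a : 'cV[R]_p).

Definition prob0 i j : R := prob_vec (X i) beta0 j 0.
Definition sd0 i j : R := Num.sqrt (prob0 i j * (1 - prob0 i j)).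
(** The factor [A_ij^(1/2) A_ik^(-1/2)] of the estimating function, at the true
    parameter. *)
Definition sd_ratio i j k : R := sd0 i j / sd0 i k.
Definition covariate_along (v : 'cV[R]_p) i j : R := (X i *m v) j 0.

Lemma prob0_itv i j : 0 < prob0 i j < 1.
Proof. by rewrite /prob0 prob_vecE logistic_itv. Qed.

Lemma sd0_gt0 i j : 0 < sd0 i j.
Proof.
by have /andP[s0 s1] := prob0_itv i j; rewrite sqrtr_gt0 mulr_gt0 // subr_gt0.
Qed.

Lemma sd0_sqr i j : sd0 i j ^+ 2 = prob0 i j * (1 - prob0 i j).
Proof.
by have /andP[s0 s1] := prob0_itv i j; rewrite sqr_sqrtr // mulr_ge0 ?subr_ge0 ?(ltW s0) ?(ltW s1).
Qed.

Lemma sd0_le1 i j : sd0 i j <= 1.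
Proof.
rewrite -[leRHS]sqrtr1 ler_wsqrtr //; have /andP[s0 s1] := prob0_itv i j.
by rewrite mulr_ile1 ?subr_ge0 ?gerBl ?(ltW s0) ?(ltW s1).
Qed.

Lemma prob_vecD delta i j : prob_vec (X i) (beta0 + delta) j 0 =
  prob0 i j + logistic_incr (prob0 i j) (covariate_along delta i j).
Proof. by rewrite /prob0 !prob_vecE mulmxDr mxE logisticD. Qed.

Lemma binvar_sqrtD delta i j : Num.sqrt (binvar (X i) (beta0 + delta) j) =
  sd0 i j / tilt (prob0 i j) (covariate_along delta i j).
Proof.
by rewrite /binvar /sd0 /prob0 !prob_vecE mulmxDr mxE sqrt_logistic_varD.
Qed.

Lemma score_coordinates (Y : 'I_n -> 'cV[R]_m) (Rhat : 'M[R]_m) delta :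
  (a^T *m score X Y Rhat (beta0 + delta)) 0 0 =
  triple_sum (fun i j k => covariate_along a i j * sd_ratio i j k *
    (invmx Rhat j k * (tilt (prob0 i k) (covariate_along delta i k) /
                       tilt (prob0 i j) (covariate_along delta i j)) *
     (Y i k 0 - prob0 i k - logistic_incr (prob0 i k) (covariate_along delta i k)))).
Proof.
rewrite /score mulmx_sumr summxE; apply: eq_bigr => i _.
rewrite !mulmxA -trmx_mul /A_half /A_mhalf diag_form_sum.
apply: eq_bigr => j _; apply: eq_bigr => k _.
have tj := tilt_gt0 (covariate_along delta i j) (prob0_itv i j).
have tk := tilt_gt0 (covariate_along delta i k) (prob0_itv i k).
have q := sd0_gt0 i k.
have -> : (Y i - prob_vec (X i) (beta0 + delta)) k 0 = Y i k 0 -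
    (prob0 i k + logistic_incr (prob0 i k) (covariate_along delta i k)).
  by rewrite -prob_vecD [LHS]mxE; congr (_ + _); rewrite mxE.
rewrite !binvar_sqrtD.
rewrite /sd_ratio /covariate_along; field.
by rewrite !gt_eqF.
Qed.

Lemma H_bar_coordinates (Rbar : 'M[R]_m) delta :
  (a^T *m H_bar X Rbar beta0 *m delta) 0 0 =
  triple_sum (fun i j k => covariate_along a i j * sd_ratio i j k *
    (invmx Rbar j k * (prob0 i k * (1 - prob0 i k) * covariate_along delta i k))).
Proof.
rewrite /H_bar mulmx_sumr mulmx_suml summxE; apply: eq_bigr => i _.
rewrite !mulmxA -trmx_mul -[_ *m X i *m delta]mulmxA /A_half diag_form_sum.
apply: eq_bigr => j _; apply: eq_bigr => k _.
have q := sd0_gt0 i k.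
rewrite -sd0_sqr -/(sd0 i j) -/(sd0 i k) /sd_ratio /covariate_along; field.
by rewrite gt_eqF.
Qed.

(** The row vector [a^T X_i^T A_i^(1/2) V]. *)
Definition standardized_row (V : 'M[R]_m) i : 'rV[R]_m :=
  (X i *m a)^T *m A_half (X i) beta0 *m V.

Lemma standardized_rowE V i k :
  standardized_row V i 0 k = \sum_j covariate_along a i j * sd0 i j * V j k.
Proof.
rewrite /standardized_row mxE; apply: eq_bigr => j _; congr (_ * _).
by rewrite mul_mx_diag 2!mxE [in X in _ * X]mxE.
Qed.

Lemma M_bar_quadratic (Rbar R0 : 'M[R]_m) : (invmx Rbar)^T = invmx Rbar ->
  (a^T *m M_bar X Rbar R0 beta0 *m a) 0 0 =
  \sum_i (standardized_row (invmx Rbar) i *m R0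
            *m (standardized_row (invmx Rbar) i)^T) 0 0.
Proof.
move=> symV; rewrite /M_bar mulmx_sumr mulmx_suml summxE; apply: eq_bigr => i _.
by rewrite /standardized_row !trmx_mul symV /A_half tr_diag_mx trmxK !mulmxA ?trmxK.
Qed.

Section cluster_distribution.
Variables (mu : 'I_n -> {ffun 'I_m -> bool} -> R) (Rbar R0 : 'M[R]_m).
Hypothesis mu_ge0 : forall i y, 0 <= mu i y.
Hypothesis mu_sum1 : forall i, \sum_y mu i y = 1.

Definition residual i (y : {ffun 'I_m -> bool}) k : R := (y k)%:R - prob0 i k.

Hypothesis mu_mean : forall i k, \sum_y mu i y * residual i y k = 0.
Hypothesis mu_cov : forall i k k',
  \sum_y mu i y * (residual i y k * residual i y k') = sd0 i k * R0 k k' * sd0 i k'.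

Lemma residual_norm_le1 i y k : `|residual i y k| <= 1.
Proof.
have /andP[s0 s1] := prob0_itv i k; rewrite /residual.
by case: (y k); rewrite ler_norml /=; apply/andP; split; lra.
Qed.

(** The contribution of one cluster to the estimating function at the true
    parameter, in the direction [a] and with the limit working correlation. *)
Definition cluster_score i (y : {ffun 'I_m -> bool}) : R :=
  \sum_j \sum_k covariate_along a i j * sd_ratio i j k
    * (invmx Rbar j k * residual i y k).

Lemma cluster_scoreE i y : cluster_score i y =
  \sum_k standardized_row (invmx Rbar) i 0 k / sd0 i k * residual i y k.
Proof.
rewrite /cluster_score exchange_big; apply: eq_bigr => k _ /=.
rewrite standardized_rowE !mulr_suml; apply: eq_bigr => j _.
by rewrite /sd_ratio; ring.
Qed.

Lemma cluster_score_mean i : \sum_y mu i y * cluster_score i y = 0.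
Proof.
under eq_bigr do rewrite cluster_scoreE mulr_sumr.
rewrite exchange_big big1 //= => k _.
rewrite (eq_bigr (fun y => standardized_row (invmx Rbar) i 0 k / sd0 i k *
   (mu i y * residual i y k))); first by rewrite -mulr_sumr mu_mean mulr0.
by move=> y _; rewrite mulrCA.
Qed.

(** The residuals have covariance [A^(1/2) R0 A^(1/2)], and the factors
    [A^(1/2)] cancel against the [A^(-1/2)] of the estimating function. *)
Lemma cluster_score_variance i : \sum_y mu i y * cluster_score i y ^+ 2 =
  (standardized_row (invmx Rbar) i *m R0 *m (standardized_row (invmx Rbar) i)^T) 0 0.
Proof.
set r := standardized_row _ _.
transitivity (\sum_k' \sum_k (r 0 k / sd0 i k) * (r 0 k' / sd0 i k') *
    (\sum_y mu i y * (residual i y k * residual i y k'))).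
  under [RHS]eq_bigr => k' _ do
    (under eq_bigr => k _ do rewrite mulr_sumr); rewrite /=.
  under [RHS]eq_bigr => k' _ do rewrite exchange_big /=.
  rewrite [RHS]exchange_big /=; apply: eq_bigr => y _.
  rewrite cluster_scoreE -/r expr2 mulr_sumr mulr_sumr; apply: eq_bigr => k' _.
  rewrite mulr_suml mulr_sumr; apply: eq_bigr => k _; ring.
clearbody r; rewrite mxE; apply: eq_bigr => k' _.
rewrite [r^T _ _]mxE mxE mulr_suml; apply: eq_bigr => k _.
rewrite mu_cov; have q := sd0_gt0 i k; have q' := sd0_gt0 i k'; field.
by rewrite !gt_eqF.
Qed.

(** Independence of the clusters removes the cross terms. *)
Lemma residual_second_moment (b : 'I_n -> R) k :
  prod_mean mu (fun om => (\sum_i b i * residual i (om i) k) ^+ 2) <= \sum_i b i ^+ 2.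
Proof.
have mean0 i : \sum_y mu i y * (b i * residual i y k) = 0.
  rewrite (eq_bigr (fun y => b i * (mu i y * residual i y k))).
    by rewrite -mulr_sumr mu_mean mulr0.
  by move=> y _; rewrite mulrCA.
rewrite (@prod_mean_variance _ _ _ mu mu_ge0 mu_sum1
  (fun i y => b i * residual i y k) _ mean0 (fun=> erefl)).
apply: ler_sum => i _; rewrite -[leRHS]mul1r -(mu_sum1 i) mulr_suml.
apply: ler_sum => y _; rewrite ler_wpM2l // exprMn ler_piMr ?sqr_ge0 //.
rewrite -real_normK ?num_real // expr_le1 //; exact: residual_norm_le1.
Qed.

End cluster_distribution.
End estimating_equation.

(** * Mean-square control of the terms linear in the residuals *)

Section remainder.
Variable R : realType.

(** Used in place of the Cauchy-Schwarz inequality, with a weight [A] that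
    balances the sizes of the two factors. *)
Lemma mul_le_weighted_mean (A u v : R) : 0 < A -> `|u * v| <= (A * u ^+ 2 + A^-1 * v ^+ 2) / 2.
Proof.
move=> A0; rewrite normrM -[u ^+ 2]real_normK ?num_real // -[v ^+ 2]real_normK ?num_real //.
move: `|u| `|v| => {}u {}v.
have -> : A * u ^+ 2 + A^-1 * v ^+ 2 = A^-1 * (A * u - v) ^+ 2 + 2 * (u * v).
  by field; rewrite gt_eqF.
have : 0 <= A^-1 * (A * u - v) ^+ 2 by rewrite mulr_ge0 ?sqr_ge0 // invr_ge0 ltW.
lra.
Qed.

Lemma half_combination_sqr (u v al be : R) :
  - 2^-1 <= al <= 2^-1 -> - 2^-1 <= be <= 2^-1 ->
  (al * u - be * v) ^+ 2 <= (u ^+ 2 + v ^+ 2) / 2.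
Proof.
move=> ab bb.
have sq (z : R) : - 2^-1 <= z <= 2^-1 -> z ^+ 2 <= 4^-1 by move=> /andP[? ?]; nra.
have Q (z w : R) : z ^+ 2 <= 4^-1 -> (z * w) ^+ 2 <= 4^-1 * w ^+ 2.
  by move=> zz; rewrite exprMn ler_wpM2r ?sqr_ge0.
have := Q _ u (sq _ ab); have := Q _ v (sq _ bb).
have := sqr_ge0 (al * u + be * v).
move: (al * u) (be * v) => p q; nra.
Qed.

Variables (n m p : nat) (X : 'I_n -> 'M[R]_(m, p)) (beta0 a : 'cV[R]_p).
Local Notation x := (covariate_along X a).
Local Notation s := (prob0 X beta0).
Local Notation c := (sd_ratio X beta0).

Variables (B Mx c0 : R).
Hypothesis x_bound : \sum_i \sum_j x i j ^+ 2 <= B.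
Hypothesis row_bound : forall i j, \sum_t X i j t ^+ 2 <= Mx.
Hypothesis c_bound : forall i j k, c i j k <= c0.

(** The derivative, in coordinate [t] of the parameter, of the weight that the
    estimating function gives to the residual [e i k] through the pair [(j,
    k)], divided by the entry of the inverse working correlation. *)
Definition slope i j k t : R :=
  x i j * c i j k * ((s i k - 2^-1) * X i k t - (s i j - 2^-1) * X i j t).

(** Sums over clusters with deterministic weights, left when the error of the
    inverse working correlation has been factored out. *)
Definition level_noise (e : 'I_n -> 'I_m -> R) : R :=
  \sum_j \sum_k (\sum_i x i j * c i j k * e i k) ^+ 2.
(** Sums over clusters with deterministic weights, left when the inverse
    working correlation and the estimation error of the parameter have been
    factored out. *)
Definition slope_noise (e : 'I_n -> 'I_m -> R) : R :=
  \sum_j \sum_k \sum_t (\sum_i slope i j k t * e i k) ^+ 2.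

Lemma sd_ratio_ge0 i j k : 0 <= c i j k.
Proof. by rewrite divr_ge0 // ltW // sd0_gt0. Qed.

Lemma sd_ratio_norm_le i j k : `|c i j k| <= c0.
Proof. by rewrite ger0_norm ?sd_ratio_ge0. Qed.

Lemma sd_ratio_sqr_le i j k : c i j k ^+ 2 <= c0 ^+ 2.
Proof. by rewrite lerXn2r ?nnegrE ?sd_ratio_ge0 // (le_trans (sd_ratio_ge0 i j k)). Qed.

Lemma slope_sqr i j k : \sum_t slope i j k t ^+ 2 <= x i j ^+ 2 * (c0 ^+ 2 * Mx).
Proof.
have /andP[s0 s1] := prob0_itv X beta0 i k.
have /andP[s0' s1'] := prob0_itv X beta0 i j.
have E t : slope i j k t ^+ 2 <= x i j ^+ 2 * c0 ^+ 2 *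
    ((X i k t ^+ 2 + X i j t ^+ 2) / 2).
  rewrite /slope exprMn; apply: ler_pM; rewrite ?sqr_ge0 //.
    by rewrite exprMn ler_wpM2l ?sqr_ge0 ?sd_ratio_sqr_le.
  by apply: half_combination_sqr; apply/andP; split; lra.
apply: (@le_trans _ _ (\sum_t x i j ^+ 2 * c0 ^+ 2 * ((X i k t ^+ 2 + X i j t ^+ 2) / 2))).
  by apply: ler_sum => t _.
rewrite -mulr_sumr -mulr_suml big_split /= -mulrA ler_wpM2l ?sqr_ge0 //.
rewrite ler_wpM2l ?sqr_ge0 //; have := row_bound i k; have := row_bound i j; lra.
Qed.

Lemma triple_sum_fst (f : 'I_n -> 'I_m -> R) :
  triple_sum (fun i j (_ : 'I_m) => f i j) = m%:R * \sum_i \sum_j f i j.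
Proof.
rewrite /triple_sum mulr_sumr; apply: eq_bigr => i _; rewrite mulr_sumr.
by apply: eq_bigr => j _; rewrite sumr_const card_ord mulr_natl.
Qed.

Lemma triple_sum_snd (f : 'I_n -> 'I_m -> R) :
  triple_sum (fun i (_ : 'I_m) k => f i k) = m%:R * \sum_i \sum_j f i j.
Proof.
rewrite /triple_sum mulr_sumr; apply: eq_bigr => i _.
by rewrite sumr_const card_ord mulr_natl.
Qed.

(** The weight [nu] will be [sqrt p], the ratio of the orders of magnitude of
    [h] and [x]. *)
Lemma cross_sum_bound (h : 'I_n -> 'I_m -> R) nu Hs : 0 < nu ->
  \sum_i \sum_j h i j ^+ 2 <= Hs ->
  triple_sum (fun i j k => `|x i j| * (`|h i j| + `|h i k|))
    <= m%:R * (nu * B + nu^-1 * Hs).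
Proof.
move=> nu0 hH.
apply: (@le_trans _ _ (triple_sum (fun i j k =>
   (nu * x i j ^+ 2) + (2^-1 * nu^-1 * h i j ^+ 2 + 2^-1 * nu^-1 * h i k ^+ 2)))).
  apply: triple_sum_le => i j k; rewrite mulrDr -!normrM.
  have := mul_le_weighted_mean (x i j) (h i j) nu0; have := mul_le_weighted_mean (x i j) (h i k) nu0; lra.
rewrite !triple_sumD triple_sum_fst triple_sum_fst triple_sum_snd -!mulrDr.
rewrite ler_wpM2l //.
have E (k : R) (f : 'I_n -> 'I_m -> R) :
    \sum_i \sum_j k * f i j ^+ 2 = k * \sum_i \sum_j f i j ^+ 2.
  by rewrite mulr_sumr; apply: eq_bigr => i _; rewrite mulr_sumr.
rewrite !E lerD ?ler_wpM2l ?(ltW nu0) //.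
have -> : 2^-1 / nu * (\sum_i \sum_j h i j ^+ 2) + 2^-1 / nu * (\sum_i \sum_j h i j ^+ 2)
   = nu^-1 * (\sum_i \sum_j h i j ^+ 2) by field; rewrite gt_eqF.
by rewrite ler_wpM2l // invr_ge0 ltW.
Qed.

Lemma double_sum_affine (c1 c2 : R) (g : 'I_m -> 'I_m -> R) :
  \sum_j \sum_k (c1 + c2 * g j k) = m%:R ^+ 2 * c1 + c2 * \sum_j \sum_k g j k.
Proof.
rewrite mulr_sumr -[X in X * c1]natrX expnS expn1 mulr_natl mulrnA.
rewrite -[m in X in X + _]card_ord -sumr_const -big_split; apply: eq_bigr => j _ /=.
by rewrite big_split /= sumr_const card_ord mulr_sumr.
Qed.

Lemma triple_sumE (f : 'I_n -> 'I_m -> 'I_m -> R) :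
  \sum_j \sum_k \sum_i f i j k = triple_sum f.
Proof.
rewrite /triple_sum [RHS]exchange_big; apply: eq_bigr => j _.
by rewrite [RHS]exchange_big.
Qed.

Lemma weighted_square_sum w : 0 <= w ->
  triple_sum (fun i j _ => w * x i j ^+ 2) <= m%:R * (w * B).
Proof.
move=> w0; rewrite triple_sum_fst ler_wpM2l //.
have -> : \sum_i \sum_j w * x i j ^+ 2 = w * \sum_i \sum_j x i j ^+ 2.
  by rewrite mulr_sumr; apply: eq_bigr => i _; rewrite mulr_sumr.
by rewrite ler_wpM2l.
Qed.

Section noise.
Variable e : 'I_n -> 'I_m -> R.

(** The random quantities [V] and [delta] do not depend on the cluster, so they
    come out of the inner sum, whatever their dependence on the responses; the
    outer sum is over [m^2 p] indices only. *)
Lemma slope_term_bound (V : 'M[R]_m) (delta : 'cV[R]_p) v A : 0 < A ->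
  (forall j k, `|V j k| <= v) ->
  `|triple_sum (fun i j k => x i j * c i j k * (V j k *
        ((s i k - 2^-1) * covariate_along X delta i k
         - (s i j - 2^-1) * covariate_along X delta i j) * e i k))|
  <= v * (m%:R ^+ 2 * A * sqnorm delta + A^-1 * slope_noise e) / 2.
Proof.
move=> A0 Vv; rewrite /triple_sum exchange_big /=.
under eq_bigr do rewrite exchange_big /=.
have -> : \sum_j \sum_k \sum_i x i j * c i j k * (V j k *
        ((s i k - 2^-1) * covariate_along X delta i k
         - (s i j - 2^-1) * covariate_along X delta i j) * e i k) =
    \sum_j \sum_k V j k * \sum_t (delta t 0 * \sum_i slope i j k t * e i k).
  apply: eq_bigr => j _; apply: eq_bigr => k _.
  under [in RHS]eq_bigr do rewrite mulr_sumr.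
  rewrite [in RHS]exchange_big /= mulr_sumr; apply: eq_bigr => i _.
  have -> : (s i k - 2^-1) * covariate_along X delta i k
      - (s i j - 2^-1) * covariate_along X delta i j =
      \sum_t delta t 0 * ((s i k - 2^-1) * X i k t - (s i j - 2^-1) * X i j t).
    have lin l : covariate_along X delta i l = \sum_t X i l t * delta t 0.
      by rewrite /covariate_along mxE.
    rewrite !lin !mulr_sumr -sumrB; apply: eq_bigr => t _; ring.
  rewrite [V j k * (\sum_t _)]mulr_sumr mulr_suml !mulr_sumr.
  by apply: eq_bigr => t _; rewrite /slope; ring.
have -> : v * (m%:R ^+ 2 * A * sqnorm delta + A^-1 * slope_noise e) / 2 =
   \sum_(j < m) \sum_(k < m) v * \sum_t
      ((A * delta t 0 ^+ 2 + A^-1 * (\sum_i slope i j k t * e i k) ^+ 2) / 2).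
  transitivity (\sum_(j < m) \sum_(k < m) (v * A * sqnorm delta / 2 +
      v * A^-1 / 2 * \sum_t (\sum_i slope i j k t * e i k) ^+ 2)).
    by rewrite double_sum_affine -/(slope_noise e); ring.
  apply: eq_bigr => j _; apply: eq_bigr => k _.
  by rewrite -mulr_suml big_split /= -!mulr_sumr -/(sqnorm delta); ring.
apply: (le_trans (ler_norm_sum _ _ _)); apply: ler_sum => j _.
apply: (le_trans (ler_norm_sum _ _ _)); apply: ler_sum => k _.
rewrite normrM ler_pM //.
apply: (le_trans (ler_norm_sum _ _ _)); apply: ler_sum => t _.
exact: mul_le_weighted_mean.
Qed.

(** The same factoring, with the matrix [D] of errors in the working
    correlation. *)
Lemma level_term_bound (D : 'I_m -> 'I_m -> R) kap : 0 <= kap ->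
  (forall j k, `|D j k| <= kap) ->
  `|triple_sum (fun i j k => x i j * c i j k * (D j k * e i k))|
  <= kap * (m%:R ^+ 2 + level_noise e).
Proof.
move=> k0 Dk; rewrite /triple_sum exchange_big /=.
under eq_bigr do rewrite exchange_big /=.
have -> : kap * (m%:R ^+ 2 + level_noise e) = \sum_(j < m) \sum_(k < m)
    kap * (1 + (\sum_i x i j * c i j k * e i k) ^+ 2).
  transitivity (\sum_(j < m) \sum_(k < m) (kap +
      kap * (\sum_i x i j * c i j k * e i k) ^+ 2)).
    by rewrite double_sum_affine -/(level_noise e); ring.
  by apply: eq_bigr => j _; apply: eq_bigr => k _; ring.
apply: (le_trans (ler_norm_sum _ _ _)); apply: ler_sum => j _.
apply: (le_trans (ler_norm_sum _ _ _)); apply: ler_sum => k _.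
have -> : \sum_i x i j * c i j k * (D j k * e i k) =
   D j k * \sum_i x i j * c i j k * e i k.
  by rewrite mulr_sumr; apply: eq_bigr => i _; rewrite mulrCA.
rewrite normrM ler_pM //; move: (\sum_i _) => z.
rewrite -[z ^+ 2]real_normK ?num_real //; have := sqr_ge0 (`|z| - 1); nra.
Qed.

End noise.

(** The estimating equation and the two noises put together. The inequality is
    deterministic: it holds for each outcome with its own [Rhat], [delta] and
    [y]. *)
Lemma linearization_remainder (Rhat Rbar : 'M[R]_m) (delta : 'cV[R]_p)
    (y : 'I_n -> {ffun 'I_m -> bool}) eta kap v nu A Hs :
  let e i k := residual X beta0 i (y i) k in
  0 < nu -> 0 < A ->
  \sum_i \sum_j covariate_along X delta i j ^+ 2 <= Hs ->
  (forall i j, `|covariate_along X delta i j| <= eta) -> 0 <= eta <= 2^-1 ->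
  (forall j k, `|invmx Rhat j k| <= v) -> 0 <= v ->
  (forall j k, `|invmx Rhat j k - invmx Rbar j k| <= kap) -> 0 <= kap -> 0 <= c0 ->
  score X (fun i => \col_j (y i j)%:R) Rhat (beta0 + delta) = 0 ->
  `|\sum_i cluster_score X beta0 a Rbar i (y i)
     - (a^T *m H_bar X Rbar beta0 *m delta) 0 0|
  <= c0 * (12 * v * eta + kap) * (m%:R * (nu * B + nu^-1 * Hs))
     + v * (m%:R ^+ 2 * A * sqnorm delta + A^-1 * slope_noise e) / 2
     + kap * (m%:R ^+ 2 + level_noise e).
Proof.
move=> e nu0 A0 hHs heta /andP[eta0 eta1] Vv v0 Vk k0 c00 root.
have z : (a^T *m score X (fun i => \col_j (y i j)%:R) Rhat (beta0 + delta)) 0 0 = 0.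
  by rewrite root mulmx0 mxE.
rewrite score_coordinates in z.
have -> : \sum_i cluster_score X beta0 a Rbar i (y i)
     - (a^T *m H_bar X Rbar beta0 *m delta) 0 0 =
  triple_sum (fun i j k => x i j * c i j k * (invmx Rbar j k *
    (e i k - s i k * (1 - s i k) * covariate_along X delta i k))).
  rewrite H_bar_coordinates -[X in _ - X]mul1r -mulNr -triple_sumZ.
  rewrite -[\sum_i _]/(triple_sum (fun i j k => x i j * c i j k *
    (invmx Rbar j k * residual X beta0 i (y i) k))) -triple_sumD.
  by do 3 (apply: eq_bigr => ? _); rewrite /e; ring.
have e1 i j : `|e i j| <= 1 by apply: residual_norm_le1.
have := @score_linearization R n m x (covariate_along X delta) s e (invmx Rhat)
  (invmx Rbar) c eta kap v c0 (prob0_itv X beta0) heta eta1 Vv Vk e1 sd_ratio_norm_le.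
move=> /(_ _)/le_trans -> //.
  rewrite -[RHS]z; do 3 (apply: eq_bigr => ? _); congr (_ * (_ * (_ - _))).
  by rewrite /e /residual mxE.
rewrite lerD ?lerD //.
- by rewrite ler_wpM2l ?cross_sum_bound // mulr_ge0 // addr_ge0 // mulr_ge0 // mulr_ge0.
- exact: slope_term_bound.
- exact: (level_term_bound e (D := fun j k => invmx Rhat j k - invmx Rbar j k)).
Qed.

(** Apart from the factor [x_ij^2 c0^2], the squared slopes in all the
    coordinates [t] add up to at most the squared norm of a covariate vector,
    of order [p]; the weight [w] will be [1 / p]. *)
Lemma noise_mean (mu : 'I_n -> {ffun 'I_m -> bool} -> R) (w : R) :
  (forall i y, 0 <= mu i y) -> (forall i, \sum_y mu i y = 1) ->
  (forall i k, \sum_y mu i y * residual X beta0 i y k = 0) -> 0 <= w -> 0 <= Mx ->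
  prod_mean mu (fun om =>
    let e i k := residual X beta0 i (om i) k in
    level_noise e + w * slope_noise e) <= m%:R * (c0 ^+ 2 * (1 + w * Mx) * B).
Proof.
move=> mu0 mu1 mean0 w0 Mx0.
pose e (om : {ffun 'I_n -> {ffun 'I_m -> bool}}) i k := residual X beta0 i (om i) k.
rewrite (prod_meanD _ (fun om => level_noise (e om)) (fun om => w * slope_noise (e om))).
rewrite prod_meanZ.
have L : prod_mean mu (fun om => level_noise (e om)) <= m%:R * (c0 ^+ 2 * B).
  rewrite /level_noise prod_mean_sum.
  apply: (@le_trans _ _ (\sum_(j < m) \sum_(k < m) \sum_i (x i j * c i j k) ^+ 2)).
    apply: ler_sum => j _; rewrite prod_mean_sum; apply: ler_sum => k _.
    exact: residual_second_moment.
  apply: le_trans (weighted_square_sum (sqr_ge0 c0)).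
  rewrite triple_sumE; apply: triple_sum_le => i j k.
  by rewrite exprMn mulrC ler_wpM2r ?sqr_ge0 ?sd_ratio_sqr_le.
have S : prod_mean mu (fun om => slope_noise (e om)) <= m%:R * (c0 ^+ 2 * Mx * B).
  rewrite /slope_noise prod_mean_sum.
  apply: (@le_trans _ _ (\sum_(j < m) \sum_(k < m) \sum_t \sum_i slope i j k t ^+ 2)).
    apply: ler_sum => j _; rewrite prod_mean_sum; apply: ler_sum => k _.
    rewrite prod_mean_sum; apply: ler_sum => t _.
    exact: residual_second_moment.
  have -> : \sum_(j < m) \sum_(k < m) \sum_t \sum_i slope i j k t ^+ 2 =
      \sum_(j < m) \sum_(k < m) \sum_i \sum_t slope i j k t ^+ 2.
    by apply: eq_bigr => j _; apply: eq_bigr => k _; rewrite exchange_big.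
  have cM0 : 0 <= c0 ^+ 2 * Mx by rewrite mulr_ge0 ?sqr_ge0.
  apply: le_trans (weighted_square_sum cM0).
    rewrite triple_sumE; apply: triple_sum_le => i j k.
    by rewrite mulrC; apply: slope_sqr.
have -> : m%:R * (c0 ^+ 2 * (1 + w * Mx) * B) =
  m%:R * (c0 ^+ 2 * B) + w * (m%:R * (c0 ^+ 2 * Mx * B)) by ring.
by rewrite lerD // ler_wpM2l.
Qed.

End remainder.

(** * Lower bounds from the eigenvalue conditions *)

Section curvature.
Variable R : realType.
Variables (n m p : nat) (X : 'I_n -> 'M[R]_(m, p)) (beta0 : 'cV[R]_p).

Lemma gram_quadratic (v : 'cV[R]_p) : (0 < n)%N ->
  \sum_i \sum_j covariate_along X v i j ^+ 2 = n%:R * (v^T *m gram X *m v) 0 0.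
Proof.
move=> n0; rewrite /gram -scalemxAr -scalemxAl [X in _ = _ * X]mxE mulrA.
rewrite mulfV ?pnatr_eq0 -?lt0n // mul1r mulmx_sumr mulmx_suml summxE.
apply: eq_bigr => i _; rewrite !mulmxA -trmx_mul -mulmxA.
by rewrite -[RHS]sqnormE.
Qed.

Lemma gram_sym : (gram X)^T = gram X.
Proof.
rewrite /gram linearZ /= raddf_sum /=; congr (_ *: _).
by apply: eq_bigr => i _; rewrite trmx_mul trmxK.
Qed.

Variables (b1 b2 b3 b4 cR CR cV CV : R) (Rbar R0 : 'M[R]_m).
Hypothesis n_gt0 : (0 < n)%N.
Hypothesis prob_bounds : forall i j, b1 <= prob0 X beta0 i j <= b2.
Hypothesis b1_gt0 : 0 < b1.
Hypothesis b2_lt1 : b2 < 1.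
Hypothesis b3_gt0 : 0 < b3.
Hypothesis gram_min : b3 <= lambda_min (gram X).
Hypothesis gram_max : lambda_max (gram X) <= b4.
Hypothesis R0_sym : R0^T = R0.
Hypothesis R0_bounds : forall x, eigenvalue R0 x -> cR <= x <= CR.
Hypothesis cR_gt0 : 0 < cR.
Hypothesis Rbar_posdef : sym_posdef Rbar.
Hypothesis Rbar_bounds : forall x, eigenvalue Rbar x -> cV <= x <= CV.
Hypothesis cV_gt0 : 0 < cV.
Hypothesis CV_gt0 : 0 < CV.

Lemma covariate_along_bounds (v : 'cV[R]_p) :
  n%:R * (b3 * sqnorm v) <= \sum_i \sum_j covariate_along X v i j ^+ 2
    <= n%:R * (b4 * sqnorm v).
Proof.
rewrite gram_quadratic // !ler_pM2l ?ltr0n //.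
apply: (symmetric_spectrum_bounds _ gram_sym) => x /(symmetric_eigenvalue_lambda gram_sym).
by move=> /andP[l u]; rewrite (le_trans gram_min) // (le_trans u).
Qed.

Lemma sd0_sqr_ge i j : b1 * (1 - b2) <= sd0 X beta0 i j ^+ 2.
Proof.
have /andP[l u] := prob_bounds i j; rewrite sd0_sqr.
by rewrite ler_pM // ?subr_ge0 ?lerB // ltW.
Qed.

Lemma invmx_posdef_sym : (invmx Rbar)^T = invmx Rbar.
Proof. by have [s _] := Rbar_posdef; rewrite trmx_inv s. Qed.

(** The bounds for [Rbar] at the vector [Rbar^-1 v]. *)
Lemma invmx_posdef_norm (v : 'cV[R]_m) :
  cV ^+ 2 * sqnorm (invmx Rbar *m v) <= sqnorm v <= CV ^+ 2 * sqnorm (invmx Rbar *m v).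
Proof.
have Ru := sym_posdef_unitmx Rbar_posdef; have [s _] := Rbar_posdef.
by have := symmetric_spectrum_norm_bounds (invmx Rbar *m v) s cV_gt0 Rbar_bounds;
  rewrite mulKVmx.
Qed.

Lemma invmx_posdef_entry j k : `|invmx Rbar j k| <= cV^-1.
Proof.
have /andP[h _] := invmx_posdef_norm (delta_mx k 0).
have s1 : sqnorm (delta_mx k 0 : 'cV[R]_m) = 1.
  rewrite /sqnorm (bigD1 k) //= big1 ?addr0; first by rewrite !mxE !eqxx expr1n.
  by move=> l /negbTE lk; rewrite mxE lk /= expr0n.
rewrite s1 in h.
have e : (invmx Rbar *m (delta_mx k 0 : 'cV[R]_m)) j 0 = invmx Rbar j k.
  by rewrite -colE mxE.
have : cV ^+ 2 * invmx Rbar j k ^+ 2 <= 1.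
  apply: le_trans h; rewrite ler_wpM2l ?sqr_ge0 // -e /sqnorm (bigD1 j) //= lerDl.
  by apply: sumr_ge0 => l _; rewrite sqr_ge0.
rewrite -exprMn -[X in _ <= X](expr1n _ 2) -real_normK ?num_real // ler_sqr ?nnegrE //.
by rewrite normrM (ger0_norm (ltW cV_gt0)) -ler_pdivlMl // mulr1.
Qed.

(** [R0] is bounded below by [cR], [Rbar^-1] stretches by at least [1 / CV],
    and the variances of the responses are at least [b1 (1 - b2)]. *)
Lemma M_bar_lower (v : 'cV[R]_p) :
  cR * (b1 * (1 - b2)) / CV ^+ 2 * \sum_i \sum_j covariate_along X v i j ^+ 2
    <= (v^T *m M_bar X Rbar R0 beta0 *m v) 0 0.
Proof.
rewrite (M_bar_quadratic _ _ _ _ invmx_posdef_sym) mulr_sumr; apply: ler_sum => i _.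
set r := standardized_row _ _ _ _ _.
have rE : r^T = invmx Rbar *m (A_half (X i) beta0 *m (X i *m v)).
  by rewrite /r /standardized_row trmx_mul invmx_posdef_sym trmx_mul trmxK /A_half tr_diag_mx.
have Q : (r *m R0 *m r^T) 0 0 >= cR * sqnorm r^T.
  have /andP[h _] := symmetric_spectrum_bounds r^T R0_sym R0_bounds.
  by rewrite trmxK in h.
apply: le_trans Q; rewrite -mulrA -mulrA ler_pM2l //.
have /andP[_ u] := invmx_posdef_norm (A_half (X i) beta0 *m (X i *m v)).
rewrite -rE in u.
have CV0 : 0 < CV ^+ 2 by rewrite exprn_gt0.
rewrite mulrA mulrC mulrA ler_pdivrMr // [leRHS]mulrC mulrC.
apply: le_trans u; rewrite /sqnorm mulr_sumr; apply: ler_sum => j _.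
have -> : (A_half (X i) beta0 *m (X i *m v)) j 0 = sd0 X beta0 i j * covariate_along X v i j.
  by rewrite /A_half mul_diag_mx 2!mxE.
by rewrite exprMn ler_wpM2r ?sqr_ge0 // sd0_sqr_ge.
Qed.

Lemma M_bar_sym : (M_bar X Rbar R0 beta0)^T = M_bar X Rbar R0 beta0.
Proof.
rewrite /M_bar raddf_sum /=; apply: eq_bigr => i _.
by rewrite !trmx_mul trmxK invmx_posdef_sym R0_sym /A_half tr_diag_mx !mulmxA.
Qed.

(** The inverse of the constant in M_bar_lower: [sum |X_i v|^2] is at most this
    multiple of [v^T M v]. *)
Definition curvature_const : R := CV ^+ 2 / (cR * (b1 * (1 - b2))).

Lemma curvature_const_gt0 : 0 < curvature_const.
Proof. by rewrite divr_gt0 ?exprn_gt0 // !mulr_gt0 // subr_gt0. Qed.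

Lemma covariate_along_M_bar (v : 'cV[R]_p) :
  \sum_i \sum_j covariate_along X v i j ^+ 2 <=
    curvature_const * (v^T *m M_bar X Rbar R0 beta0 *m v) 0 0.
Proof.
apply: le_trans (ler_wpM2l (ltW curvature_const_gt0) (M_bar_lower v)).
have K : curvature_const * (cR * (b1 * (1 - b2)) / CV ^+ 2) = 1.
  rewrite /curvature_const; field.
  by rewrite !gt_eqF // subr_gt0.
by rewrite [leRHS]mulrA K mul1r.
Qed.

Lemma M_bar_posdef : sym_posdef (M_bar X Rbar R0 beta0).
Proof.
split; first exact: M_bar_sym.
move=> v v0; have s0 := sqnorm_gt0 v0.
rewrite -(pmulr_rgt0 _ curvature_const_gt0).
apply: lt_le_trans (covariate_along_M_bar v).
have /andP[l _] := covariate_along_bounds v.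
by apply: lt_le_trans l; rewrite mulr_gt0 ?ltr0n // mulr_gt0.
Qed.

Lemma row_sqr_le i j : \sum_t X i j t ^+ 2 <= max_covariate_norm X ^+ 2.
Proof.
have -> : \sum_t X i j t ^+ 2 = fnorm (row j (X i)) ^+ 2.
  rewrite /fnorm sqr_sqrtr; last first.
    by apply: sumr_ge0 => ? _; apply: sumr_ge0 => ? _; rewrite sqr_ge0.
  by rewrite big_ord1; apply: eq_bigr => t _; rewrite mxE.
rewrite lerXn2r ?nnegrE ?sqrtr_ge0 //.
  by rewrite /max_covariate_norm; apply: bigmax_ge_id.
rewrite /max_covariate_norm; apply: le_trans (le_bigmax _ _ i).
exact: (le_bigmax _ (fun j => fnorm (row j (X i))) j).
Qed.

Lemma covariate_along_le (v : 'cV[R]_p) i j :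
  covariate_along X v i j ^+ 2 <= max_covariate_norm X ^+ 2 * sqnorm v.
Proof.
rewrite /covariate_along mxE; apply: le_trans (cauchy_schwarz_sum _ _) _.
by rewrite ler_wpM2r ?sqnorm_ge0 ?row_sqr_le.
Qed.

End curvature.

(** * The remainder for one sample size *)

Section one_sample.
Variable R : realType.
Variables (n m p : nat) (X : 'I_n -> 'M[R]_(m, p)) (beta0 a : 'cV[R]_p).
Variables (b1 b2 b3 b4 cV C1 k : R) (Rbar : 'M[R]_m).
Hypothesis n_gt0 : (0 < n)%N.
Hypothesis p_gt0 : (0 < p)%N.
Hypothesis prob_bounds : forall i j, b1 <= prob0 X beta0 i j <= b2.
Hypothesis b1_gt0 : 0 < b1.
Hypothesis b2_lt1 : b2 < 1.
Hypothesis b3_gt0 : 0 < b3.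
Hypothesis b4_gt0 : 0 < b4.
Hypothesis covariate_bounds : forall v : 'cV[R]_p,
  n%:R * (b3 * sqnorm v) <= \sum_i \sum_j covariate_along X v i j ^+ 2
    <= n%:R * (b4 * sqnorm v).
Hypothesis Vbar_entry : forall j l, `|invmx Rbar j l| <= cV^-1.
Hypothesis cV_gt0 : 0 < cV.
Hypothesis C1_gt0 : 0 < C1.
Hypothesis a_bound : \sum_i \sum_j covariate_along X a i j ^+ 2 <= C1.
Hypothesis k_gt0 : 0 < k.
Hypothesis cov_bound : max_covariate_norm X <= k * Num.sqrt p%:R.

(** The order [sqrt (p / n)] of the estimation error. All the errors are
    compared with [p * rate = sqrt (p^3 / n)]. *)
Definition rate : R := Num.sqrt (p%:R / n%:R).
Definition sd_ratio_max : R := (Num.sqrt (b1 * (1 - b2)))^-1.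
(** The slope noise is divided by [p], its order of magnitude, so that one
    bound on the mean serves both noises. *)
Definition noise (om : 'I_n -> {ffun 'I_m -> bool}) : R :=
  let e i l := residual X beta0 i (om i) l in
  level_noise X beta0 a e + p%:R^-1 * slope_noise X beta0 a e.

Let sp : R := Num.sqrt p%:R.
Let sn : R := Num.sqrt n%:R.

Let sp_ge1 : 1 <= sp.
Proof. by rewrite -[leLHS]sqrtr1 ler_wsqrtr // ler1n. Qed.

Let sp_sqr : sp ^+ 2 = p%:R.
Proof. by rewrite sqr_sqrtr. Qed.

Let sn_gt0 : 0 < sn.
Proof. by rewrite sqrtr_gt0 ltr0n. Qed.

Let rateE : rate = sp / sn.
Proof. by rewrite /rate sqrtrM // sqrtrV. Qed.

Lemma rate_ge0 : 0 <= rate.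
Proof. by rewrite sqrtr_ge0. Qed.

Lemma rate_sqr : rate ^+ 2 = p%:R / n%:R.
Proof. by rewrite sqr_sqrtr // divr_ge0. Qed.

Lemma rate_le_scaled : sp * rate <= p%:R * rate.
Proof. by rewrite ler_wpM2r ?rate_ge0 // -sp_sqr expr2 ler_peMl // (le_trans _ sp_ge1). Qed.

Lemma rate_le : rate <= p%:R * rate.
Proof. by rewrite ler_peMl ?rate_ge0 // ler1n. Qed.

Lemma sd_ratio_le i j l : sd_ratio X beta0 i j l <= sd_ratio_max.
Proof.
have q0 : 0 < b1 * (1 - b2) by rewrite mulr_gt0 // subr_gt0.
have h : Num.sqrt (b1 * (1 - b2)) <= sd0 X beta0 i l.
  by rewrite -[leRHS]ger0_norm ?(ltW (sd0_gt0 _ _ _ _)) // -sqrtr_sqr ler_wsqrtr // (sd0_sqr_ge prob_bounds).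
rewrite /sd_ratio -[leRHS]mul1r ler_pM ?invr_ge0 ?sd0_le1 ?(ltW (sd0_gt0 _ _ _ _)) //.
by rewrite lef_pV2 ?posrE ?sd0_gt0 ?sqrtr_gt0.
Qed.

Lemma sd_ratio_max_gt0 : 0 < sd_ratio_max.
Proof. by rewrite invr_gt0 sqrtr_gt0 mulr_gt0 // subr_gt0. Qed.

Lemma max_cov_sqr : max_covariate_norm X ^+ 2 <= k ^+ 2 * p%:R.
Proof.
rewrite -sp_sqr -exprMn lerXn2r ?nnegrE //.
  by rewrite /max_covariate_norm; apply: bigmax_ge_id.
by rewrite mulr_ge0 ?sqrtr_ge0 ?ltW.
Qed.

Lemma sqnorm_a_le : sqnorm a <= C1 / (n%:R * b3).
Proof.
rewrite ler_pdivlMr ?mulr_gt0 ?ltr0n // mulrC -mulrA.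
by have /andP[h _] := covariate_bounds a; apply: le_trans h a_bound.
Qed.

Definition score_bound_const : R :=
  m%:R ^+ 2 * (sd_ratio_max * cV^-1) * (k * Num.sqrt (C1 / b3)).

(** [|x_ij|] is at most the product of the norm of a covariate vector, [O(sqrt
    p)], and of the norm of [a], [O(1 / sqrt n)]. *)
Lemma cluster_score_bound i y :
  `|cluster_score X beta0 a Rbar i y| <= score_bound_const * (p%:R * rate).
Proof.
have xb j : `|covariate_along X a i j| <= k * Num.sqrt (C1 / b3) * rate.
  have r0 : 0 <= k * Num.sqrt (C1 / b3) * rate.
    by rewrite !mulr_ge0 ?sqrtr_ge0 ?rate_ge0 // ltW.
  rewrite -(ler_sqr) ?nnegrE // real_normK ?num_real //.
  apply: le_trans (covariate_along_le _ _ _ _) _.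
  apply: le_trans (ler_wpM2r (sqnorm_ge0 a) max_cov_sqr) _.
  have s1 : Num.sqrt (C1 / b3) ^+ 2 = C1 / b3.
    by rewrite sqr_sqrtr // divr_ge0 ?(ltW C1_gt0) ?(ltW b3_gt0).
  have E : (k * Num.sqrt (C1 / b3) * rate) ^+ 2 = k ^+ 2 * p%:R * (C1 / (n%:R * b3)).
    by rewrite !exprMn s1 rate_sqr; field; rewrite gt_eqF //= pnatr_eq0 -lt0n.
  by rewrite E ler_wpM2l ?sqnorm_a_le // mulr_ge0 ?sqr_ge0.
apply: (@le_trans _ _ (\sum_(j < m) \sum_(l < m)
   (k * Num.sqrt (C1 / b3) * rate) * sd_ratio_max * (cV^-1 * 1))).
  apply: (le_trans (ler_norm_sum _ _ _)); apply: ler_sum => j _.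
  apply: (le_trans (ler_norm_sum _ _ _)); apply: ler_sum => l _.
  rewrite (normrM (_ * _)) (normrM (covariate_along X a i j)) (normrM (invmx Rbar j l)).
  apply: ler_pM; rewrite ?mulr_ge0 //.
    apply: ler_pM => //; exact: (sd_ratio_norm_le sd_ratio_le).
  by apply: ler_pM => //; apply: residual_norm_le1.
rewrite sumr_const card_ord sumr_const card_ord -mulrnA -[leLHS]mulr_natl natrM.
have -> : m%:R * m%:R * (k * Num.sqrt (C1 / b3) * rate * sd_ratio_max * (cV^-1 * 1))
  = score_bound_const * rate by rewrite /score_bound_const; ring.
rewrite ler_wpM2l ?rate_le // /score_bound_const.
have sd0 := ltW sd_ratio_max_gt0.
by rewrite !mulr_ge0 ?invr_ge0 ?sqrtr_ge0 ?(ltW cV_gt0) ?(ltW k_gt0).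
Qed.

Definition remainder_const (K K1 K2 : R) : R :=
  sd_ratio_max * (12 * (cV^-1 + 1) * (k * K1) + K2) * (m%:R * (C1 + b4 * K1 ^+ 2))
  + (cV^-1 + 1) * (m%:R ^+ 2 * K1 ^+ 2 + K) / 2 + K2 * (m%:R ^+ 2 + K).

(** The weights are [nu = sqrt p] and [A = sqrt n]. The hypotheses on [k * K1]
    and [K2] make the shifts at most 1/2 and the error of the working
    correlation at most 1, which holds as soon as [p * rate] is small. *)
Lemma one_sample_remainder (Rhat : 'M[R]_m) (delta : 'cV[R]_p)
    (y : 'I_n -> {ffun 'I_m -> bool}) (K K1 K2 : R) :
  0 < K -> 0 < K1 -> 0 < K2 ->
  fnorm delta <= K1 * rate -> fnorm (invmx Rhat - invmx Rbar) <= K2 * rate ->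
  noise y <= K -> k * K1 * (p%:R * rate) <= 2^-1 -> K2 * (p%:R * rate) <= 1 ->
  score X (fun i => \col_j (y i j)%:R) Rhat (beta0 + delta) = 0 ->
  `|\sum_i cluster_score X beta0 a Rbar i (y i)
     - (a^T *m H_bar X Rbar beta0 *m delta) 0 0| <= remainder_const K K1 K2 * (p%:R * rate).
Proof.
move=> K0 K10 K20 dK1 VK2 nK small1 small2 root.
have r0 := rate_ge0.
have cv0 : 0 < cV^-1 by rewrite invr_gt0.
have sq_delta : sqnorm delta <= K1 ^+ 2 * rate ^+ 2.
  by rewrite -fnorm_sqr -exprMn lerXn2r ?nnegrE ?sqrtr_ge0 // mulr_ge0 // ltW.
have hHs : \sum_i \sum_j covariate_along X delta i j ^+ 2 <= b4 * K1 ^+ 2 * p%:R.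
  have /andP[_ h] := covariate_bounds delta; apply: le_trans h _.
  have -> : b4 * K1 ^+ 2 * p%:R = n%:R * (b4 * (K1 ^+ 2 * rate ^+ 2)).
    by rewrite rate_sqr; field; rewrite gt_eqF // ltr0n.
  by rewrite !ler_wpM2l // ltW.
pose eta := k * K1 * (sp * rate).
have eta0 : 0 <= eta by rewrite !mulr_ge0 ?(ltW k_gt0) ?(ltW K10) // (le_trans _ sp_ge1).
have heta i j : `|covariate_along X delta i j| <= eta.
  rewrite -ler_sqr ?nnegrE // real_normK ?num_real //.
  apply: le_trans (covariate_along_le _ _ _ _) _.
  have -> : eta ^+ 2 = k ^+ 2 * p%:R * (K1 ^+ 2 * rate ^+ 2) by rewrite /eta -sp_sqr; ring.
  by rewrite ler_pM ?sqr_ge0 ?sqnorm_ge0 ?max_cov_sqr.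
have eta1 : eta <= 2^-1.
  by apply: le_trans small1; rewrite ler_wpM2l ?rate_le_scaled // mulr_ge0 // ltW.
pose kap := K2 * rate.
have kap0 : 0 <= kap by rewrite mulr_ge0 // ltW.
have kap1 : kap <= 1.
  by apply: le_trans small2; rewrite ler_wpM2l ?rate_le // ltW.
have Vk j l : `|invmx Rhat j l - invmx Rbar j l| <= kap.
  apply: le_trans VK2; rewrite /fnorm -sqrtr_sqr ler_wsqrtr //.
  rewrite (bigD1 j) //= (bigD1 l) //= !mxE -addrA lerDl addr_ge0 //.
    by apply: sumr_ge0 => ? _; rewrite sqr_ge0.
  by apply: sumr_ge0 => ? _; apply: sumr_ge0 => ? _; rewrite sqr_ge0.
have Vv j l : `|invmx Rhat j l| <= cV^-1 + 1.
  rewrite -[invmx Rhat j l](subrK (invmx Rbar j l)) addrC.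
  by rewrite (le_trans (ler_normD _ _)) // lerD // (le_trans (Vk j l)).
have lev0 : 0 <= level_noise X beta0 a (fun i l => residual X beta0 i (y i) l).
  by apply: sumr_ge0 => ? _; apply: sumr_ge0 => ? _; rewrite sqr_ge0.
have slo0 : 0 <= slope_noise X beta0 a (fun i l => residual X beta0 i (y i) l).
  by do 3 (apply: sumr_ge0 => ? _); rewrite sqr_ge0.
have lev : level_noise X beta0 a (fun i l => residual X beta0 i (y i) l) <= K.
  by apply: le_trans nK; rewrite /noise lerDl mulr_ge0 // invr_ge0.
have slo : slope_noise X beta0 a (fun i l => residual X beta0 i (y i) l) <= K * p%:R.
  rewrite -ler_pdivrMr ?ltr0n // mulrC.
  by apply: le_trans nK; rewrite /noise lerDr.
have c00 := ltW sd_ratio_max_gt0.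
have sp0 : 0 < sp by apply: lt_le_trans sp_ge1.
have e01 : 0 <= eta <= 2^-1 by rewrite eta0 eta1.
have v10 : 0 <= cV^-1 + 1 by rewrite addr_ge0 // ltW.
have := @linearization_remainder R n m p X beta0 a C1 sd_ratio_max a_bound sd_ratio_le
  Rhat Rbar delta y eta kap (cV^-1 + 1) sp sn (b4 * K1 ^+ 2 * p%:R) sp0 sn_gt0 hHs heta
  e01 Vv v10 Vk kap0 c00 root.
move=> /le_trans; apply.
set tau := p%:R * rate.
have tau0 : 0 <= tau by rewrite mulr_ge0.
have sps : sp * rate <= tau := rate_le_scaled.
have rt : rate <= tau := rate_le.
have spsp : sp * (sp * rate) = tau by rewrite mulrA -expr2 sp_sqr.
have mC : 0 <= m%:R * (C1 + b4 * K1 ^+ 2).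
  by rewrite mulr_ge0 // addr_ge0 ?(ltW C1_gt0) // mulr_ge0 ?sqr_ge0 // ltW.
rewrite /remainder_const; set v := cV^-1 + 1 in v10 *; set c0 := sd_ratio_max in c00 *.
have -> : (c0 * (12 * v * (k * K1) + K2) * (m%:R * (C1 + b4 * K1 ^+ 2)) +
  v * (m%:R ^+ 2 * K1 ^+ 2 + K) / 2 + K2 * (m%:R ^+ 2 + K)) * tau =
  c0 * (m%:R * (C1 + b4 * K1 ^+ 2)) * (12 * v * (k * K1) * tau + K2 * tau) +
  v * (m%:R ^+ 2 * (K1 ^+ 2 * tau) + K * tau) / 2 + K2 * tau * (m%:R ^+ 2 + K) by ring.
apply: lerD; first apply: lerD.
- have -> : c0 * (12 * v * eta + kap) * (m%:R * (sp * C1 + sp^-1 * (b4 * K1 ^+ 2 * p%:R)))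
    = c0 * (m%:R * (C1 + b4 * K1 ^+ 2)) *
      (12 * v * (k * K1) * (sp * (sp * rate)) + K2 * (sp * rate)).
    by rewrite -sp_sqr /eta /kap; field; rewrite gt_eqF.
  by rewrite spsp ler_wpM2l ?(mulr_ge0 c00 mC) // lerD2l ler_wpM2l // ltW.
- rewrite ler_pM2r // ler_wpM2l //; apply: lerD.
    rewrite -mulrA ler_wpM2l ?sqr_ge0 //.
    apply: le_trans (ler_wpM2l (ltW sn_gt0) sq_delta) _.
    have -> : sn * (K1 ^+ 2 * rate ^+ 2) = K1 ^+ 2 * (sp * rate).
      have snr : sn * rate = sp by rewrite rateE mulrC divfK ?gt_eqF.
      by rewrite -snr; ring.
    by rewrite ler_wpM2l ?sqr_ge0.
  apply: (@le_trans _ _ (sn^-1 * (K * p%:R))).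
    by rewrite ler_wpM2l // invr_ge0 ltW.
  have -> : sn^-1 * (K * p%:R) = K * (sp * rate) by rewrite rateE -sp_sqr; ring.
  by rewrite ler_wpM2l // ltW.
- by apply: ler_pM => //; rewrite ?addr_ge0 ?sqr_ge0 //; [rewrite ler_wpM2l // ltW | rewrite lerD2l].
Qed.

End one_sample.

(** * Binary responses have a finite law *)

Section finite_law.
Context d (T : measurableType d) (R : realType) (P : probability T R).

Section one_map.
Variables (F : finType) (c : T -> F).
Hypothesis mc : forall y, measurable [set w | c w = y].

Lemma finite_expectation (G : F -> R) :
  ('E_P[fun w => G (c w)])%E = (\sum_y fine (P [set w | c w = y]) * G y)%:E.
Proof.
have -> : (fun w => G (c w)) = fun w => \sum_y G y * \1_[set w | c w = y] w.
  apply/funext => w; rewrite (bigD1 (c w)) //= indicE mem_set //= mulr1.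
  rewrite big1 ?addr0 // => y /eqP yc; rewrite indicE memNset ?mulr0 //=.
  by move=> /esym.
rewrite unlock.
under eq_integral do rewrite -sumEFin.
rewrite integral_sum //; last first.
  move=> y; have := integrableZl measurableT (G y) (integrable_indic P (mc y)).
  by apply: eq_integrable => // w _; rewrite EFinM.
rewrite -sumEFin; apply: eq_bigr => y _.
under eq_integral do rewrite EFinM.
rewrite integralZl //; last exact: integrable_indic.
by rewrite integral_indic // setIT EFinM fineK ?fin_num_measure // muleC.
Qed.

Lemma finite_map_measurable (pr : pred F) : measurable [set w | pr (c w)].
Proof.
have -> : [set w | pr (c w)] = \bigcup_(y in [set y | pr y]) [set w | c w = y].
  apply/seteqP; split => [w /= pw|w [y /= py cy]]; [by exists (c w) | by rewrite /= cy].
by apply: fin_bigcup_measurable.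
Qed.

Lemma finite_probability (pr : pred F) :
  P [set w | pr (c w)] = (\sum_y fine (P [set w | c w = y]) * (pr y)%:R)%:E.
Proof.
have mpr := finite_map_measurable pr.
rewrite -finite_expectation -(expectation_indic P mpr); congr expectation.
apply/funext => w; rewrite indicE; congr (_%:R); apply/esym.
by case: (boolP (pr (c w))) => h; [rewrite mem_set | rewrite memNset //=; apply/negP].
Qed.

End one_map.

Section binary_clusters.
Variables (n m : nat) (Y : 'I_n -> 'I_m -> {RV P >-> R}).
Hypothesis Y_binary : forall i j w, Y i j w = 0 \/ Y i j w = 1.
Hypothesis Y_indep : independent_vectors P (fun i j => Y i j : T -> R).

Definition response i w : {ffun 'I_m -> bool} := [ffun j => Y i j w == 1].
Definition cluster_law i (y : {ffun 'I_m -> bool}) : R :=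
  fine (P [set w | response i w = y]).
Definition responses w : {ffun 'I_n -> {ffun 'I_m -> bool}} :=
  [ffun i => response i w].

Lemma responseE i j w : Y i j w = (response i w j)%:R.
Proof. by rewrite ffunE; case: (Y_binary i j w) => ->; rewrite ?eqxx // eq_sym oner_eq0. Qed.

Lemma response_set i y : [set w | response i w = y] =
  \bigcap_(j in [set: 'I_m]) [set w | (Y i j w == 1) = y j].
Proof.
apply/seteqP; split => [w /= <- j _ /=|w /= h]; first by rewrite ffunE.
by apply/ffunP => j; rewrite ffunE; apply: h.
Qed.

Lemma coordinate_set i j b : exists2 B : set R, measurable B &
  [set w | (Y i j w == 1) = b] = Y i j @^-1` B.
Proof.
case: b; [exists [set 1] => // | exists (~` [set 1]); first exact: measurableC].
  by apply/seteqP; split => w /= /eqP.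
by apply/seteqP; split => w /=; [move/negbT/eqP | move/eqP/negbTE].
Qed.

Lemma response_measurable i y : measurable [set w | response i w = y].
Proof.
rewrite response_set; apply: fin_bigcap_measurable => // j _.
have [B mB ->] := coordinate_set i j (y j).
by rewrite -[X in measurable X]setTI; apply: measurable_funP.
Qed.

(** The event belongs to the sigma-algebra generated by the cluster, which is
    what the independence hypothesis asks for. *)
Lemma response_sigma i y :
  g_sigma_preimage (Y i : 'I_m -> T -> R) [set w | response i w = y].
Proof.
rewrite response_set.
apply: (@fin_bigcap_measurable _ (g_sigma_algebraType
   (\big[setU/set0]_(j < m) preimage_set_system setT (Y i j : T -> R) measurable))) => // j _.
have [B mB ->] := coordinate_set i j (y j).
apply: sub_sigma_algebra; rewrite (bigD1 j) //=; left.
by exists B; rewrite // setTI.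
Qed.

Lemma responses_set om : [set w | responses w = om] =
  \bigcap_(i in [set: 'I_n]) [set w | response i w = om i].
Proof.
apply/seteqP; split => [w /= <- i _ /=|w /= h]; first by rewrite ffunE.
by apply/ffunP => i; rewrite ffunE; apply: h.
Qed.

Lemma responses_measurable om : measurable [set w | responses w = om].
Proof.
by rewrite responses_set; apply: fin_bigcap_measurable => // i _; apply: response_measurable.
Qed.

Lemma responses_law om : fine (P [set w | responses w = om]) = prod_pmf cluster_law om.
Proof.
rewrite responses_set Y_indep; last by move=> i; apply: response_sigma.
have -> : (\prod_(i < n) P [set w | response i w = om i])%E =
    (prod_pmf cluster_law om)%:E.
  rewrite /prod_pmf -prodEFin; apply: eq_bigr => i _.
  by rewrite fineK // fin_num_measure //; apply: response_measurable.
by [].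
Qed.

Lemma cluster_law_ge0 i y : 0 <= cluster_law i y.
Proof. by rewrite fine_ge0. Qed.

Lemma cluster_law_sum1 i : \sum_y cluster_law i y = 1.
Proof.
have := finite_probability (response_measurable i) predT.
have -> : [set w | predT (response i w)] = setT by apply/seteqP; split.
rewrite probability_setT => -[->]; apply: eq_bigr => y _; by rewrite mulr1.
Qed.

Lemma responses_probability (pr : pred {ffun 'I_n -> {ffun 'I_m -> bool}}) :
  P [set w | pr (responses w)] = (prod_mean cluster_law (fun om => (pr om)%:R))%:E.
Proof.
rewrite (finite_probability responses_measurable); congr (_%:E).
by apply: eq_bigr => om _; rewrite responses_law.
Qed.

Lemma cluster_law_mean i j : ('E_P[Y i j])%E = (\sum_y cluster_law i y * (y j)%:R)%:E.
Proof.
rewrite -(finite_expectation (response_measurable i)); congr expectation.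
by apply/funext => w; rewrite responseE.
Qed.

Lemma cluster_law_covariance i j k a b :
  ('E_P[Y i j])%E = a%:E -> ('E_P[Y i k])%E = b%:E ->
  fine (covariance P (Y i j) (Y i k)) =
    \sum_y cluster_law i y * (((y j)%:R - a) * ((y k)%:R - b)).
Proof.
move=> Ea Eb; rewrite covariance.unlock Ea Eb /=.
have -> : ((Y i j \- cst a) * (Y i k \- cst b))%R =
    fun w => ((response i w j)%:R - a) * ((response i w k)%:R - b).
  by apply/funext => w; rewrite -!responseE.
by rewrite (finite_expectation (response_measurable i)
  (fun y => ((y j)%:R - a) * ((y k)%:R - b))).
Qed.

End binary_clusters.
End finite_law.

(** * Asymptotic normality *)

Section sandwich.
Context d (T : measurableType d) (R : realType) (P : probability T R).

Lemma prob_le_setU (A B C : set T) (b : R) :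
  measurable A -> measurable B -> measurable C -> A `<=` B `|` C ->
  (P C <= b%:E)%E -> fine (P A) <= fine (P B) + b.
Proof.
move=> mA mB mC ABC Cb.
rewrite -lee_fin EFinD !fineK ?fin_num_measure //.
apply: (@le_trans _ _ (P (B `|` C))).
  by apply: le_measure; rewrite ?inE //; exact: measurableU.
by apply: le_trans (measureU2 _ mB mC) _; rewrite leeD2l.
Qed.

Lemma cdf_sandwich (F : finType) (c : T -> F) (W : F -> R) (Z : T -> R)
    (Bad : set T) (x t b : R) :
  (forall y, measurable [set w | c w = y]) -> measurable_fun setT Z ->
  measurable Bad -> (P Bad <= b%:E)%E ->
  (forall w, ~ Bad w -> `|W (c w) - Z w| <= t) ->
  fine (P [set w | W (c w) <= x - t]) - b <= fine (P [set w | Z w <= x])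
    <= fine (P [set w | W (c w) <= x + t]) + b.
Proof.
move=> mc mZ mB PB close.
have mW z : measurable [set w | W (c w) <= z].
  exact: (finite_map_measurable mc (fun y => W y <= z)).
have mZx : measurable [set w | Z w <= x].
  have -> : [set w | Z w <= x] = setT `&` Z @^-1` `]-oo, x]%classic.
    by rewrite setTI; apply/seteqP; split => w /=; rewrite in_itv.
  exact: mZ.
apply/andP; split.
  rewrite lerBlDr; apply: (prob_le_setU _ _ mB _ PB) => // w /= Wx.
  have [Bw|Bw] := pselect (Bad w); [by right|left].
  by have := close w Bw; rewrite ler_norml => /andP[? ?]; rewrite /=; lra.
apply: (prob_le_setU _ _ mB _ PB) => // w /= Zx.
have [Bw|Bw] := pselect (Bad w); [by right|left].
by have := close w Bw; rewrite ler_norml => /andP[? ?]; rewrite /=; lra.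
Qed.

Lemma prob_setU4 (A B C D : set T) (e : R) :
  measurable A -> measurable B -> measurable C -> measurable D ->
  (P A <= e%:E)%E -> (P B <= e%:E)%E -> (P C <= e%:E)%E -> (P D <= e%:E)%E ->
  (P (A `|` B `|` C `|` D) <= (4 * e)%:E)%E.
Proof.
move=> mA mB mC mD PA PB PC PD.
have -> : 4 * e = e + e + e + e by ring.
have mAB := measurableU _ _ mA mB; have mABC := measurableU _ _ mAB mC.
rewrite !EFinD; apply: le_trans (measureU2 _ mABC mD) _; apply: leeD => //.
apply: le_trans (measureU2 _ mAB mC) _; apply: leeD => //.
by apply: le_trans (measureU2 _ mA mB) _; apply: leeD.
Qed.

End sandwich.

Section cluster_moments.
Context d (T : measurableType d) (R : realType) (P : probability T R).
Variables (n m p : nat) (X : 'I_n -> 'M[R]_(m, p)) (beta0 : 'cV[R]_p).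
Variables (Y : 'I_n -> 'I_m -> {RV P >-> R}) (R0 : 'M[R]_m).
Hypothesis Y_binary : forall i j w, Y i j w = 0 \/ Y i j w = 1.
Hypothesis Y_mean : forall i j, ('E_P[Y i j] = (prob0 X beta0 i j)%:E)%E.
Hypothesis Y_corr : forall i j k, R0 j k = correlation P (Y i j) (Y i k).

Lemma cluster_residual_mean i k :
  \sum_y cluster_law Y i y * residual X beta0 i y k = 0.
Proof.
have := cluster_law_mean Y_binary i k; rewrite Y_mean => -[E].
under eq_bigr do rewrite /residual mulrBr.
by rewrite sumrB -E -mulr_suml cluster_law_sum1 mul1r subrr.
Qed.

Lemma cluster_covariance i j k : fine (covariance P (Y i j) (Y i k)) =
  \sum_y cluster_law Y i y * (residual X beta0 i y j * residual X beta0 i y k).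
Proof. by rewrite (cluster_law_covariance Y_binary (Y_mean i j) (Y_mean i k)). Qed.

(** The variance of a binary variable of mean [s] is [s (1 - s)]. *)
Lemma cluster_sd i j : Num.sqrt (fine ('V_P[Y i j])%E) = sd0 X beta0 i j.
Proof.
rewrite /variance cluster_covariance; congr Num.sqrt.
transitivity (\sum_y (cluster_law Y i y * residual X beta0 i y j * (1 - 2 * prob0 X beta0 i j)
   + cluster_law Y i y * (prob0 X beta0 i j * (1 - prob0 X beta0 i j)))).
  apply: eq_bigr => y _; rewrite /residual.
  by case: (y j) => /=; ring.
by rewrite big_split /= -!mulr_suml cluster_residual_mean cluster_law_sum1 mul0r add0r mul1r.
Qed.

Lemma cluster_residual_cov i j k :
  \sum_y cluster_law Y i y * (residual X beta0 i y j * residual X beta0 i y k) =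
    sd0 X beta0 i j * R0 j k * sd0 X beta0 i k.
Proof.
rewrite -cluster_covariance (Y_corr i) /correlation !cluster_sd.
have := sd0_gt0 X beta0 i j; have := sd0_gt0 X beta0 i k => q q'.
by field; rewrite !gt_eqF.
Qed.

Lemma correlation_matrix_sym : (0 < n)%N -> R0^T = R0.
Proof.
move=> n0; apply/matrixP => j k; rewrite mxE !(Y_corr (Ordinal n0)) /correlation.
by rewrite covarianceC [X in _ / X]mulrC.
Qed.

End cluster_moments.

Section one_sample_law.
Context d (T : measurableType d) (R : realType) (P : probability T R).
Variables (n m p : nat) (X : 'I_n -> 'M[R]_(m, p)) (beta0 alpha : 'cV[R]_p).
Variables (Y : 'I_n -> 'I_m -> {RV P >-> R}) (R0 Rbar : 'M[R]_m).
Variables (Rhat : T -> 'M[R]_m) (betahat : T -> 'cV[R]_p).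
Variables (b1 b2 b3 b4 cR CR cV CV k : R).
Hypothesis m_gt0 : (0 < m)%N.
Hypothesis n_gt0 : (0 < n)%N.
Hypothesis p_gt0 : (0 < p)%N.
Hypothesis Y_binary : forall i j w, Y i j w = 0 \/ Y i j w = 1.
Hypothesis Y_indep : independent_vectors P (fun i j => Y i j : T -> R).
Hypothesis Y_mean : forall i j, ('E_P[Y i j] = (prob0 X beta0 i j)%:E)%E.
Hypothesis Y_corr : forall i j k, R0 j k = correlation P (Y i j) (Y i k).
Hypothesis Rhat_meas : measurable_mx Rhat.
Hypothesis betahat_meas : measurable_mx betahat.
Hypothesis prob_bounds : forall i j, b1 <= prob0 X beta0 i j <= b2.
Hypothesis b1_gt0 : 0 < b1.
Hypothesis b2_lt1 : b2 < 1.
Hypothesis b3_gt0 : 0 < b3.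
Hypothesis b4_gt0 : 0 < b4.
Hypothesis gram_min : b3 <= lambda_min (gram X).
Hypothesis gram_max : lambda_max (gram X) <= b4.
Hypothesis R0_bounds : forall x, eigenvalue R0 x -> cR <= x <= CR.
Hypothesis cR_gt0 : 0 < cR.
Hypothesis Rbar_posdef : sym_posdef Rbar.
Hypothesis Rbar_bounds : forall x, eigenvalue Rbar x -> cV <= x <= CV.
Hypothesis cV_gt0 : 0 < cV.
Hypothesis CV_gt0 : 0 < CV.
Hypothesis k_gt0 : 0 < k.
Hypothesis cov_bound : max_covariate_norm X <= k * Num.sqrt p%:R.
Hypothesis alpha_unit : fnorm alpha = 1.

Let C1 := curvature_const b1 b2 cR CV.
Let tau : R := p%:R * rate R n p.
(** The bound of noise_mean, with the squared covariate norms at most [k^2 p]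
    and the weight [1 / p]. *)
Definition noise_const (C : R) : R :=
  m%:R * (sd_ratio_max b1 b2 ^+ 2 * (1 + k ^+ 2) * C).

(** The exceptional event is the union of four: the working correlation or the
    estimate is farther from its limit than [K2] or [K1] times the rate, the
    estimate is not a root, or the noise exceeds [K]. By Markov's inequality
    [K], the bound of the mean noise over [e], makes the last one of
    probability at most [e]. *)
Lemma one_sample_law (K1 K2 e t : R) :
  let K := noise_const C1 / e in
  0 < e -> 0 < K1 -> 0 < K2 ->
  (P [set w | (K2 * rate R n p < `|fnorm (invmx (Rhat w) - invmx Rbar)|)%R] <= e%:E)%E ->
  (P [set w | (K1 * rate R n p < `|fnorm (betahat w - beta0)|)%R] <= e%:E)%E ->
  1 - e <= fine (P [set w | score X (fun i => \col_j Y i j w) (Rhat w) (betahat w) = 0]) ->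
  k * K1 * tau <= 2^-1 -> K2 * tau <= 1 ->
  remainder_const m b1 b2 b4 cV C1 k K K1 K2 * tau <= t ->
  exists mu xi : 'I_n -> {ffun 'I_m -> bool} -> R,
    [/\ forall i y, 0 <= mu i y, forall i, \sum_y mu i y = 1,
        forall i, \sum_y mu i y * xi i y = 0,
        \sum_i \sum_y mu i y * xi i y ^+ 2 = 1
      & forall i y, `|xi i y| <= score_bound_const m b1 b2 b3 cV C1 k * tau] /\
    forall x, prod_mean mu (fun om => (\sum_i xi i (om i) <= x - t)%R%:R) - 4 * e
      <= fine (P [set w | ((alpha^T *m invmx (mxsqrt (M_bar X Rbar R0 beta0))
          *m H_bar X Rbar beta0 *m (betahat w - beta0)) 0 0 <= x)%R])
      <= prod_mean mu (fun om => (\sum_i xi i (om i) <= x + t)%R%:R) + 4 * e.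
Proof.
move=> K e0 K10 K20 PV Pd Proot small1 small2 rem.
have R0_sym := correlation_matrix_sym Y_corr n_gt0.
have Mpos : sym_posdef (M_bar X Rbar R0 beta0).
  exact: (M_bar_posdef n_gt0 prob_bounds b1_gt0 b2_lt1 b3_gt0 gram_min gram_max R0_sym
    R0_bounds cR_gt0 Rbar_posdef Rbar_bounds cV_gt0 CV_gt0).
have [a aE aM] := sym_posdef_whitening alpha Mpos.
have {aM}aM : (a^T *m M_bar X Rbar R0 beta0 *m a) 0 0 = 1.
  by rewrite aM -fnorm_sqr alpha_unit expr1n.
have C10 : 0 < C1 by exact: curvature_const_gt0.
have a_bound : \sum_i \sum_j covariate_along X a i j ^+ 2 <= C1.
  rewrite -[leRHS]mulr1 -aM.
  exact: (covariate_along_M_bar prob_bounds b1_gt0 b2_lt1 R0_sym R0_bounds cR_gt0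
    Rbar_posdef Rbar_bounds cV_gt0 CV_gt0).
have cov_along v := covariate_along_bounds n_gt0 gram_min gram_max v.
have Ventry j l := invmx_posdef_entry Rbar_posdef Rbar_bounds cV_gt0 j l.
pose mu := cluster_law Y.
have mu0 i y : 0 <= mu i y by exact: cluster_law_ge0.
have mu1 i : \sum_y mu i y = 1 by exact: cluster_law_sum1.
have mean0 i l := cluster_residual_mean Y_binary Y_mean i l.
have cov i j l := cluster_residual_cov Y_binary Y_mean Y_corr i j l.
exists mu, (cluster_score X beta0 a Rbar); split.
  split => //.
  - by move=> i; apply: cluster_score_mean.
  - rewrite -aM (M_bar_quadratic _ _ _ _ (invmx_posdef_sym Rbar_posdef)).
    by apply: eq_bigr => i _; apply: cluster_score_variance.
  - by move=> i y; apply: cluster_score_bound.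
move=> x; rewrite aE.
pose Z w := (a^T *m H_bar X Rbar beta0 *m (betahat w - beta0)) 0 0.
have mdelta : measurable_mx (fun w => betahat w - beta0).
  by apply: measurable_mxD => //; apply: measurable_mx_cst.
have mZ : measurable_fun setT Z.
  by apply: measurable_mx_mul => //; apply: measurable_mx_cst.
pose BV := [set w | (K2 * rate R n p < `|fnorm (invmx (Rhat w) - invmx Rbar)|)%R].
pose Bd := [set w | (K1 * rate R n p < `|fnorm (betahat w - beta0)|)%R].
pose Br := ~` [set w | score X (fun i => \col_j Y i j w) (Rhat w) (betahat w) = 0].
pose Bn := [set w | K < noise X beta0 a (responses Y w)].
have mgt (f : T -> R) z : measurable_fun setT f -> measurable [set w | (z < `|f w|)%R].
  move=> mf; have -> : [set w | (z < `|f w|)%R] =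
      setT `&` (fun w => `|f w|) @^-1` `]z, +oo[%classic.
    by rewrite setTI; apply/seteqP; split => w /=; rewrite in_itv /= andbT.
  by apply: (measurableT_comp _ mf).
have mBV : measurable BV.
  apply: mgt; apply: measurable_fnorm; apply: measurable_mxD.
    exact: measurable_invmx.
  exact: measurable_mx_cst.
have mBd : measurable Bd by apply: mgt; apply: measurable_fnorm.
have mroot : measurable [set w | score X (fun i => \col_j Y i j w) (Rhat w) (betahat w) = 0].
  apply: measurable_mx_eq0; apply: measurable_score => // i j l.
  apply: (eq_measurable_fun (Y i j)); last exact: measurable_funP.
  by move=> w _; rewrite mxE.
have mBr : measurable Br by exact: measurableC.
have mBn : measurable Bn.
  exact: (finite_map_measurable (responses_measurable Y)
    (fun om : {ffun 'I_n -> {ffun 'I_m -> bool}} => K < noise X beta0 a om)).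
have PBr : (P Br <= e%:E)%E.
  rewrite probability_setC // -[X in (1 - X)%E]fineK ?fin_num_measure // -EFinB lee_fin.
  by rewrite lerBlDr addrC -lerBlDr.
have K0 : 0 < noise_const C1.
  rewrite mulr_gt0 ?ltr0n // mulr_gt0 // mulr_gt0 ?exprn_gt0 ?sd_ratio_max_gt0 //.
  by rewrite ltr_pwDl // sqr_ge0.
have Kpos : 0 < K by rewrite divr_gt0.
have noise0 om : 0 <= noise X beta0 a om.
  rewrite addr_ge0 //; last rewrite mulr_ge0 ?invr_ge0 //.
    by do 2 (apply: sumr_ge0 => ? _); rewrite sqr_ge0.
  by do 3 (apply: sumr_ge0 => ? _); rewrite sqr_ge0.
have PBn : (P Bn <= e%:E)%E.
  rewrite (responses_probability Y_indep
    (fun om : {ffun 'I_n -> {ffun 'I_m -> bool}} => K < noise X beta0 a om)) lee_fin.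
  apply: (@le_trans _ _ (prod_mean mu (fun om => K^-1 * noise X beta0 a om))).
    apply: prod_mean_le => // om; case: ltP => h /=.
      by rewrite mulrC ler_pdivlMr // mul1r ltW.
    by rewrite mulr_ge0 // invr_ge0 ltW.
  rewrite prod_meanZ.
  have h : prod_mean mu (fun om => noise X beta0 a om) <= noise_const C1.
    have row i j : \sum_s X i j s ^+ 2 <= k ^+ 2 * p%:R.
      by apply: le_trans (row_sqr_le X i j) _; apply: max_cov_sqr.
    have p0 : 0 <= (p%:R : R)^-1 by rewrite invr_ge0.
    have M0 : 0 <= k ^+ 2 * p%:R by rewrite mulr_ge0 ?sqr_ge0.
    have := noise_mean a_bound row (sd_ratio_le prob_bounds b1_gt0 b2_lt1) mu0 mu1 mean0 p0 M0.
    rewrite /noise_const; have -> // : (p%:R : R)^-1 * (k ^+ 2 * p%:R) = k ^+ 2.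
    by field; rewrite pnatr_eq0 -lt0n.
  rewrite mulrC ler_pdivrMr //; apply: le_trans h _.
  by rewrite /K mulrC divfK // gt_eqF.
have PBad := prob_setU4 mBV mBd mBr mBn PV Pd PBr PBn.
have mBad : measurable (BV `|` Bd `|` Br `|` Bn).
  by do 3 (apply: measurableU => //).
have close w : ~ (BV `|` Bd `|` Br `|` Bn) w ->
    `|\sum_i cluster_score X beta0 a Rbar i (responses Y w i) - Z w| <= t.
  move=> nB; apply: le_trans rem.
  have nV : fnorm (invmx (Rhat w) - invmx Rbar) <= K2 * rate R n p.
    rewrite -[leLHS]ger0_norm ?sqrtr_ge0 // leNgt; apply/negP => h.
    by apply: nB; left; left; left.
  have nd : fnorm (betahat w - beta0) <= K1 * rate R n p.
    rewrite -[leLHS]ger0_norm ?sqrtr_ge0 // leNgt; apply/negP => h.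
    by apply: nB; left; left; right.
  have nn : noise X beta0 a (responses Y w) <= K.
    by rewrite leNgt; apply/negP => h; apply: nB; right.
  have nr : score X (fun i => \col_j (responses Y w i j)%:R) (Rhat w)
      (beta0 + (betahat w - beta0)) = 0.
    have [//|h] := pselect (score X (fun i => \col_j Y i j w) (Rhat w) (betahat w) = 0).
      move=> root; rewrite addrC subrK -[RHS]root; congr (score X _ _ _).
      by apply/funext => i; apply/colP => j; rewrite !mxE [responses Y w i]ffunE responseE.
    by exfalso; apply: nB; left; right.
  exact: (one_sample_remainder n_gt0 p_gt0 prob_bounds b1_gt0 b2_lt1 b4_gt0 cov_along
    Ventry cV_gt0 C10 a_bound k_gt0 cov_bound Kpos K10 K20 nd nV nn small1 small2 nr).
have := @cdf_sandwich _ _ _ P _ (responses Y)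
  (fun om : {ffun 'I_n -> {ffun 'I_m -> bool}} =>
    \sum_i cluster_score X beta0 a Rbar i (om i))
  Z _ x t _ (responses_measurable Y) mZ mBad PBad close.
have cW z : fine (P [set w | \sum_i cluster_score X beta0 a Rbar i (responses Y w i) <= z]) =
   prod_mean mu (fun om => (\sum_i cluster_score X beta0 a Rbar i (om i) <= z)%R%:R).
  by rewrite (responses_probability Y_indep (fun om : {ffun 'I_n -> {ffun 'I_m -> bool}} =>
     \sum_i cluster_score X beta0 a Rbar i (om i) <= z)).
by rewrite !cW.
Qed.

End one_sample_law.

Theorem theorem3p8 (R : realType) (m : nat) (p : nat -> nat)
  (d : nat -> measure_display) (T : forall n, measurableType (d n))
  (P : forall n, probability (T n) R)
  (X : forall n, 'I_n -> 'M[R]_(m, p n))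
  (Y : forall n, 'I_n -> 'I_m -> {RV (P n) >-> R})
  (B : forall n, set 'cV[R]_(p n)) (beta0 : forall n, 'cV[R]_(p n))
  (R0 Rbar : nat -> 'M[R]_m) (Rhat : forall n, T n -> 'M[R]_m)
  (betahat : forall n, T n -> 'cV[R]_(p n))
  (b1 b2 b3 b4 : R)
  (m_gt0 : (0 < m)%N)
  (p_infty : p n @[n --> \oo] --> \oo)
  (Y_binary : forall n i j w, Y n i j w = 0 \/ Y n i j w = 1)
  (Y_indep : forall n, independent_vectors (P n) (fun i j => Y n i j : T n -> R))
  (Y_mean : forall n i j,
     ('E_(P n)[Y n i j] = (prob_vec (X n i) (beta0 n) j 0)%:E)%E)
  (Y_corr : forall n i j k, R0 n j k = correlation (P n) (Y n i j) (Y n i k))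
  (Rhat_meas : forall n, measurable_mx (Rhat n))
  (betahat_meas : forall n, measurable_mx (betahat n))
  (A1 : (fun n => max_covariate_norm (X n) : R^o)
          =O_\oo (fun n => Num.sqrt (p n)%:R : R^o))
  (A2_compact : forall n, compact (B n))
  (A2_interior : forall n, (B n)° (beta0 n))
  (A2_b1 : 0 < b1) (A2_b2 : b2 < 1)
  (A2_prob : forall n i j, b1 <= prob_vec (X n i) (beta0 n) j 0 <= b2)
  (A3_b3 : 0 < b3) (A3_b4 : 0 < b4)
  (A3 : forall n, (0 < n)%N ->
     [/\ b3 <= lambda_min (gram (X n)),
         lambda_min (gram (X n)) <= lambda_max (gram (X n))
       & lambda_max (gram (X n)) <= b4])
  (A4_R0 : eigenvalues_bounded_away R0)
  (A4_Rbar_posdef : forall n, sym_posdef (Rbar n))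
  (A4_Rbar : eigenvalues_bounded_away Rbar)
  (A4_Rhat : bigO_prob P
     (fun n w => fnorm (invmx (Rhat n w) - invmx (Rbar n)))
     (fun n => Num.sqrt ((p n)%:R / n%:R)))
  (betahat_root :
     P n [set w | score (X n) (fun i => \col_j Y n i j w) (Rhat n w)
                    (betahat n w) = 0] @[n --> \oo] --> 1%E)
  (betahat_rate : bigO_prob P
     (fun n w => fnorm (betahat n w - beta0 n))
     (fun n => Num.sqrt ((p n)%:R / n%:R)))
  (p_rate : (fun n => n%:R^-1 * (p n)%:R ^+ 3 : R^o) =o_\oo (fun=> 1 : R^o))
  (alpha : forall n, 'cV[R]_(p n))
  (alpha_unit : forall n, (0 < n)%N -> fnorm (alpha n) = 1) :
  cvg_in_distribution P
    (fun n w =>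
       ((alpha n)^T *m invmx (mxsqrt (M_bar (X n) (Rbar n) (R0 n) (beta0 n)))
          *m H_bar (X n) (Rbar n) (beta0 n)
          *m (betahat n w - beta0 n)) 0 0)
    (normal_prob 0 1).
Proof.
move=> x _.
have PhiE : normal_prob (0:R) 1 `]-oo, x]%classic = (std_cdf x)%:E.
  by rewrite /std_cdf fineK // fin_num_measure.
rewrite [X in _ --> X]PhiE.
apply/fine_cvgP; split.
  apply: nearW => n; apply: fin_num_measure.
  have mlin : measurable_fun setT (fun w => ((alpha n)^T
      *m invmx (mxsqrt (M_bar (X n) (Rbar n) (R0 n) (beta0 n)))
      *m H_bar (X n) (Rbar n) (beta0 n) *m (betahat n w - beta0 n)) 0 0).
    apply: measurable_mx_mul; first exact: measurable_mx_cst.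
    by apply: measurable_mxD => //; apply: measurable_mx_cst.
  rewrite -[X in measurable X]setTI.
  have := mlin measurableT _ (measurable_itv `]-oo, x]).
  by congr (measurable (_ `&` _)); apply/seteqP; split => w /=; rewrite in_itv.
apply/cvgrPdist_le => e0 e0_gt0.
pose e := e0 / 8; have e_gt0 : 0 < e by rewrite divr_gt0.
have [cR [CR [cR_gt0 R0b]]] := A4_R0.
have [cV [CV' [cV_gt0 RV]]] := A4_Rbar.
(* The maximum makes the upper bound positive without exhibiting an eigenvalue. *)
pose CV := Num.max CV' cV.
have CV_gt0 : 0 < CV by rewrite lt_max cV_gt0 orbT.
have Rbar_b n y : eigenvalue (Rbar n) y -> cV <= y <= CV.
  by move=> /RV /andP[l u]; rewrite l /= le_max u.
have [k k_gt0 kA1] : exists2 k, 0 < k &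
    \forall n \near \oo, max_covariate_norm (X n) <= k * Num.sqrt (p n)%:R.
  move/eqOP : A1 => [k0 [_ h]].
  exists (`|k0| + 1); first by rewrite ltr_pwDr.
  have := h (`|k0| + 1); rewrite (le_lt_trans (ler_norm k0)) ?ltrDl // => /(_ isT).
  apply: filterS => n /=; rewrite (ger0_norm (sqrtr_ge0 _)).
  by apply: le_trans; apply: ler_norm.
have [K2 K2_gt0 near2] := A4_Rhat e e_gt0.
have [K1 K1_gt0 near1] := betahat_rate e e_gt0.
have near_root : \forall n \near \oo, 1 - e <= fine (P n [set w | score (X n)
     (fun i => \col_j Y n i j w) (Rhat n w) (betahat n w) = 0]).
  move/fine_cvgP : betahat_root => [_ /cvgrPdist_le /(_ _ e_gt0)].
  apply: filterS => n /=; rewrite ler_norml => /andP[_ h]; lra.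
(* 16 is the Lipschitz constant of the normal distribution function. *)
pose t := e / 16; have t_gt0 : 0 < t by rewrite divr_gt0.
have [eps1 eps1_gt0 clt1] := clt_bounded (x - t) e_gt0.
have [eps2 eps2_gt0 clt2] := clt_bounded (x + t) e_gt0.
pose C1 := curvature_const b1 b2 cR CV.
pose K := noise_const m b1 b2 k C1 / e.
pose Kr := remainder_const m b1 b2 b4 cV C1 k K K1 K2.
pose Ks := score_bound_const m b1 b2 b3 cV C1 k.
pose tau n : R := (p n)%:R * rate R n (p n).
have tau0 : tau n @[n --> \oo] --> (0:R).
  have tauE n : (0 < n)%N -> tau n ^+ 2 = n%:R^-1 * (p n)%:R ^+ 3.
    by move=> n_gt0; rewrite exprMn rate_sqr; field; rewrite pnatr_eq0 -lt0n.
  apply/cvgrPdist_le => c c_gt0.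
  move/eqoP : p_rate => /(_ (c ^+ 2)); rewrite exprn_gt0 // => /(_ isT) small.
  near=> n; rewrite sub0r normrN -ler_sqr ?nnegrE ?(ltW c_gt0) // real_normK ?num_real //.
  rewrite tauE; last by near: n; exists 1%N => // i /=; rewrite -lt0n.
  apply: (@le_trans _ _ (c ^+ 2 * `|1 : R|)); last by rewrite normr1 mulr1.
  by apply: le_trans (ler_norm _) _; near: n.
have near_tau (c d0 : R) : 0 < d0 -> \forall n \near \oo, c * tau n <= d0.
  move=> d0_gt0; have c1 : 0 < `|c| + 1 by rewrite ltr_pwDr.
  have /cvgrPdist_le /(_ (d0 / (`|c| + 1))) := tau0.
  rewrite divr_gt0 // => /(_ isT); apply: filterS => n.
  rewrite sub0r normrN ler_pdivlMr // => h.
  apply: le_trans h; rewrite (le_trans (ler_norm _)) // normrM mulrC ler_wpM2l //.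
  by rewrite lerDl.
have near_pos : \forall n \near \oo, (0 < n)%N by exists 1%N => // n /=; rewrite -lt0n.
near=> n.
have n_gt0 : (0 < n)%N by near: n.
have p_gt0 : (0 < p n)%N.
  rewrite lt0n; apply/eqP => p0; have := alpha_unit n n_gt0.
  rewrite /fnorm big1 ?sqrtr0; first by move/eqP; rewrite eq_sym oner_eq0.
  by move=> i _; have := ltn_ord i; rewrite {2}p0.
have [g1 _ g2] := A3 n n_gt0.
have hk : max_covariate_norm (X n) <= k * Num.sqrt (p n)%:R by near: n; exact: kA1.
have h2 : (P n [set w | (K2 * rate R n (p n) <
    `|fnorm (invmx (Rhat n w) - invmx (Rbar n))|)%R] <= e%:E)%E by near: n; exact: near2.
have h1 : (P n [set w | (K1 * rate R n (p n) <
    `|fnorm (betahat n w - beta0 n)|)%R] <= e%:E)%E by near: n; exact: near1.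
have hr : 1 - e <= fine (P n [set w | score (X n)
    (fun i => \col_j Y n i j w) (Rhat n w) (betahat n w) = 0]).
  by near: n; exact: near_root.
have s1 : k * K1 * tau n <= 2^-1 by near: n; apply: near_tau; rewrite invr_gt0.
have s2 : K2 * tau n <= 1 by near: n; apply: near_tau.
have s3 : Kr * tau n <= t by near: n; apply: near_tau.
have [mu [xi [[mu0 mu1 mean0 var1 bd] sand]]] :=
  one_sample_law m_gt0 n_gt0 p_gt0 (Y_binary n) (Y_indep n) (Y_mean n) (Y_corr n)
   (Rhat_meas n) (betahat_meas n) (A2_prob n) A2_b1 A2_b2 A3_b3 A3_b4 g1 g2
   (R0b n) cR_gt0 (A4_Rbar_posdef n) (Rbar_b n) cV_gt0 CV_gt0 k_gt0
   hk (alpha_unit n n_gt0) e_gt0 K1_gt0 K2_gt0 h2 h1 hr s1 s2 s3.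
have b1' : Ks * tau n <= eps1 by near: n; apply: near_tau.
have b2' : Ks * tau n <= eps2 by near: n; apply: near_tau.
have bd1 i y : `|xi i y| <= eps1 := le_trans (bd i y) b1'.
have bd2 i y : `|xi i y| <= eps2 := le_trans (bd i y) b2'.
have /andP[_ up] := clt2 _ _ mu xi mu0 mu1 mean0 var1 bd2.
have /andP[dn _] := clt1 _ _ mu xi mu0 mu1 mean0 var1 bd1.
have /andP[sd su] := sand x.
have l1 := std_cdf_lipschitz (x - t) x; have l2 := std_cdf_lipschitz (x + t) x.
have d1 : x - t - x = - t by ring.
have d2 : x + t - x = t by ring.
rewrite d1 normrN in l1; rewrite d2 in l2; rewrite (gtr0_norm t_gt0) in l1 l2.
have tE : 16 * t = e by rewrite /t; field.
rewrite tE in l1 l2; move: l1 l2; rewrite !ler_norml => /andP[l1 l1'] /andP[l2 l2'].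
have eE : e0 = 8 * e by rewrite /e; field.
rewrite eE /=; apply/andP; split; lra.
Unshelve. all: by end_near.
Qed.
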